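(* Let $\beta>0$, let $\sigma=\sigma_\beta=(1-e^{-\beta})e^{-\beta\mathbf a^\dagger\mathbf a}$, and for $p\ge1$ let $$\alpha_p=\inf_{\rho}\frac{\mathcal E_p(\rho)}{D(\rho\|\sigma)}$$ be the $p$-log-Sobolev constant of the quantum Ornstein–Uhlenbeck semigroup with parameter $\beta$, where the infimum is over all single-mode states $\rho\neq\sigma$ with finite mean photon number. Then for $p>1$, with $\hat p$ the Hölder conjugate of $p$, $$\alpha_p=\frac{p\hat p}{4\beta}\,e^{\beta/2}\big(1-e^{-\beta/p}\big)\big(1-e^{-\beta/\hat p}\big),$$ and for $p=1$, $$\alpha_1=\lim_{p\to1^+}\alpha_p=\tfrac12\sinh(\beta/2).$$
   Context: Single-mode bosonic system: Hilbert space with orthonormal (Fock) basis $\{|n\rangle:n\ge0\}$, $\mathbf a|n\rangle=\sqrt n|n-1\rangle$, $\mathbf a^\dagger|n\rangle=\sqrt{n+1}|n+1\rangle$. States are positive semidefinite operators of trace one. If $\rho=\sum_j\lambda_j|\psi_j\rangle\langle\psi_j|$ is an eigen-decomposition, $\rho$ has finite mean photon number if every $\psi_j$ with $\lambda_j>0$ is in the domain of $\mathbf a$ and $\mathrm{tr}(\rho\mathbf a^\dagger\mathbf a):=\sum_j\lambda_j\|\mathbf a\psi_j\|^2<\infty$; similarly $\mathrm{tr}(\rho\mathbf a\mathbf a^\dagger):=\sum_j\lambda_j\|\mathbf a^\dagger\psi_j\|^2$. $\frac1p+\frac1{\hat p}=1$. The quantum Ornstein–Uhlenbeck semigroup is $\Phi_t=e^{-t\mathcal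 L}$ with $$\mathcal L(\rho)=e^{-\beta/2}\big(\tfrac12\{\mathbf a\mathbf a^\dagger,\rho\}-\mathbf a^\dagger\rho\mathbf a\big)+e^{\beta/2}\big(\tfrac12\{\mathbf a^\dagger\mathbf a,\rho\}-\mathbf a\rho\mathbf a^\dagger\big);$$ its Heisenberg-picture generator (adjoint for $\langle X,Y\rangle=\mathrm{tr}(X^\dagger Y)$) is $$\mathcal L^*(X)=e^{-\beta/2}\big(\tfrac12\{\mathbf a\mathbf a^\dagger,X\}-\mathbf aX\mathbf a^\dagger\big)+e^{\beta/2}\big(\tfrac12\{\mathbf a^\dagger\mathbf a,X\}-\mathbf a^\dagger X\mathbf a\big),$$ and $\sigma$ is its fixed state. Let $\Gamma_\sigma^{s}(X)=\sigma^{s/2}X\sigma^{s/2}$ and $\langle X,Y\rangle_\sigma=\mathrm{tr}(\sigma^{1/2}X^\dagger\sigma^{1/2}Y)$. The Dirichlet form is $$\mathcal E_p(\rho)=\frac{p\hat p}{4}\Big\langle\Gamma_\sigma^{-1/\hat p}(\rho^{1/\hat p}),\,\mathcal L^*\circ\Gamma_\sigma^{-1/p}(\rho^{1/p})\Big\rangle_\sigma ,$$ which for $p>1$ and $\rho$ with finite mean photon number is understood as the (finite) quantity $$\frac{p\hat p}{4}\Big(e^{-\beta/2}\big[\mathrm{tr}(\rho\mathbf a\mathbf a^\dagger)-e^{\beta/p}\mathrm{tr}(\rho^{1/\hat p}\mathbf a\rho^{1/p}\mathbf a^\dagger)\big]+e^{\beta/2}\big[\mathrm{tr}(\rho\mathbf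 a^\dagger\mathbf a)-e^{-\beta/p}\mathrm{tr}(\rho^{1/\hat p}\mathbf a^\dagger\rho^{1/p}\mathbf a)\big]\Big),$$ with $\mathrm{tr}(\rho^{1/\hat p}\mathbf a\rho^{1/p}\mathbf a^\dagger)=\sum_{i,j}\lambda_i^{1/\hat p}\lambda_j^{1/p}|\langle\psi_i|\mathbf a|\psi_j\rangle|^2$ and $\mathrm{tr}(\rho^{1/\hat p}\mathbf a^\dagger\rho^{1/p}\mathbf a)=\sum_{i,j}\lambda_i^{1/\hat p}\lambda_j^{1/p}|\langle\psi_j|\mathbf a|\psi_i\rangle|^2$. For $p=1$, $\mathcal E_1(\rho)=\frac14\langle\log\rho-\log\sigma,\mathcal L^*\circ\Gamma_\sigma^{-1}(\rho)\rangle_\sigma$, understood as the limit of $\mathcal E_p(\rho)$ as $p\to1^+$ (possibly $+\infty$). $D(\rho\|\sigma)=\mathrm{tr}(\rho\log\rho)-\mathrm{tr}(\rho\log\sigma)$ (natural logarithm), which here equals $-S(\rho)+\beta\,\mathrm{tr}(\rho\mathbf a^\dagger\mathbf a)-\log(1-e^{-\beta})$ with $S(\rho)=-\mathrm{tr}(\rho\log\rho)$. *)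

(* Defs.v *)
From HB Require Import structures.
From mathcomp Require Import all_boot all_order all_algebra.
From mathcomp Require Import complex.
From mathcomp Require Import all_classical all_reals all_analysis.
From mathcomp Require Import ring lra.

Set Implicit Arguments.
Unset Strict Implicit.
Unset Printing Implicit Defensive.

Import Order.TTheory GRing.Theory Num.Theory.
Import numFieldNormedType.Exports.

Local Open Scope classical_set_scope.
Local Open Scope ring_scope.
Local Open Scope complex_scope.

Definition sqmod (R : realType) (z : R[i]) : R :=
  complex.Re z ^+ 2 + complex.Im z ^+ 2.

(* The single-mode Hilbert space is realised as l^2(nat; C): a vector u is the
   sequence of its Fock coefficients u n = <n|u>. *)

Definition sqnorm (R : realType) (u : nat -> R[i]) : \bar R :=
  (\sum_(0 <= n <oo) (sqmod (u n))%:E)%E.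

Definition square_summable (R : realType) : {pred nat -> R[i]} :=
  fun u => (sqnorm u < +oo)%E.

Lemma sqmod_ge0 (R : realType) (z : R[i]) : 0 <= sqmod z.
Proof. by rewrite addr_ge0 ?sqr_ge0. Qed.

Lemma sqmodM (R : realType) (z w : R[i]) : sqmod (z * w) = sqmod z * sqmod w.
Proof. by case: z w => a b [c d]; rewrite /sqmod /=; ring. Qed.

Lemma sqmod_real (R : realType) (x : R) : sqmod x%:C = x ^+ 2.
Proof. by rewrite /sqmod /=; ring. Qed.

Lemma le_sqmodD (R : realType) (z w : R[i]) :
  sqmod (z + w) <= 2 * sqmod z + 2 * sqmod w.
Proof.
case: z w => a b [c d]; rewrite /sqmod /=.
have := sqr_ge0 (a - c); have := sqr_ge0 (b - d); lra.
Qed.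

Lemma square_summable_submod_closed (R : realType) :
  submod_closed (@square_summable R).
Proof.
split=> [|a u v]; rewrite !unfold_in /square_summable.
  by rewrite /sqnorm eseries0 ?ltry// => n _ _; rewrite /sqmod /= !expr0n addr0.
move=> ufin vfin; pose w n := ((2 * sqmod a)%:E * (sqmod (u n))%:E
                               + 2%:E * (sqmod (v n))%:E)%E.
apply: (@le_lt_trans _ _ (\sum_(0 <= n <oo) w n)%E).
  apply: lee_nneseries => n _; first by rewrite lee_fin sqmod_ge0.
  by rewrite /w -!EFinM -EFinD lee_fin -mulrA -sqmodM; exact: le_sqmodD.
rewrite nneseriesD; last 2 first.
- by move=> n _ _; rewrite -EFinM lee_fin !mulr_ge0 ?sqmod_ge0.
- by move=> n _ _; rewrite -EFinM lee_fin mulr_ge0 ?sqmod_ge0.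
rewrite !nneseriesZl; try by move=> n _; rewrite lee_fin sqmod_ge0.
rewrite -!/(sqnorm _) lte_add_pinfty// lte_mul_pinfty// ?lee_fin//.
by rewrite mulr_ge0 ?sqmod_ge0.
Qed.

HB.instance Definition _ (R : realType) :=
  GRing.isSubmodClosed.Build R[i] (nat -> R[i]) (@square_summable R)
    (@square_summable_submod_closed R).

Record ell2 (R : realType) := Ell2 {
  coef :> nat -> R[i] ;
  coefP : coef \in @square_summable R }.
HB.instance Definition _ (R : realType) := [isSub for @coef R].
HB.instance Definition _ (R : realType) := [Choice of ell2 R by <:].
HB.instance Definition _ (R : realType) :=
  [SubChoice_isSubLmodule of ell2 R by <:].

(* R[i] carries no topology in the library, so the series is summed on real and
   imaginary parts separately; it converges absolutely when u and v are square
   summable. Antilinear in the first argument. *)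
Definition braket (R : realType) (u v : nat -> R[i]) : R[i] :=
  limn (series (fun n => complex.Re ((u n)^* * v n)))
    +i* limn (series (fun n => complex.Im ((u n)^* * v n))).

Definition fock_seq (R : realType) (m : nat) : nat -> R[i] :=
  fun n => (n == m)%:R.

Lemma fock_seqP (R : realType) (m : nat) : @fock_seq R m \in @square_summable R.
Proof.
rewrite unfold_in /square_summable /sqnorm.
rewrite (nneseries_split 0 m.+1); last by move=> k _; rewrite lee_fin sqmod_ge0.
rewrite eseries0 ?adde0 => [|n + _]; last first.
  rewrite add0n => mn; rewrite /fock_seq gtn_eqF// /sqmod /= expr0n addr0//.
by rewrite sumEFin ltry.
Qed.

Definition fock (R : realType) (m : nat) : ell2 R := Ell2 (fock_seqP R m).

(* The ladder operators act on arbitrary sequences. *)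
Definition annih (R : realType) (u : nat -> R[i]) : nat -> R[i] :=
  fun n => (Num.sqrt n.+1%:R)%:C * u n.+1.

Definition creat (R : realType) (u : nat -> R[i]) : nat -> R[i] :=
  fun n => if n is m.+1 then (Num.sqrt n%:R)%:C * u m else 0.

Definition dom_annih (R : realType) (u : ell2 R) : Prop :=
  annih u \in @square_summable R.

(* A positive operator defined on the whole space is automatically bounded and
   self-adjoint. The order on R[i] makes [0 <= z] include that z is real. *)
Definition psd (R : realType) (rho : ell2 R -> ell2 R) : Prop :=
  forall u : ell2 R, 0 <= braket u (rho u).

(* For positive operators only: the diagonal entries are then nonnegative. *)
Definition trace (R : realType) (rho : ell2 R -> ell2 R) : \bar R :=
  (\sum_(0 <= n <oo) (complex.Re (braket (fock R n) (rho (fock R n))))%:E)%E.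

Definition state (R : realType) (rho : ell2 R -> ell2 R) : Prop :=
  [/\ linear rho, psd rho & trace rho = 1%E].

(* rho = sum_j lam j |psi j><psi j| in the strong sense; the kernel of rho need
   not be spanned by the psi j, and finite-rank rho have lam j = 0 eventually
   or on some of the indices. *)
Definition eigen_decomposition (R : realType) (rho : ell2 R -> ell2 R)
    (lam : nat -> R) (psi : nat -> ell2 R) : Prop :=
  [/\ forall j, 0 <= lam j,
      forall i j, braket (psi i) (psi j) = (i == j)%:R &
      forall u : ell2 R, sqnorm (rho u - \sum_(j < N)
        ((lam j)%:C * braket (psi j) u) *: psi j) @[N --> \oo] --> 0%E].

Section functionals.
Variables (R : realType) (beta : R).
Implicit Types (p : R) (lam : nat -> R) (psi : nat -> ell2 R).

Local Open Scope ereal_scope.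

(* tr(rho a^dagger a) and tr(rho a a^dagger) *)
Definition mean_num lam psi : \bar R :=
  \sum_(0 <= j <oo) (lam j)%:E * sqnorm (annih (psi j)).
Definition mean_antinum lam psi : \bar R :=
  \sum_(0 <= j <oo) (lam j)%:E * sqnorm (creat (psi j)).

Definition finite_mean_photon lam psi : Prop :=
  (forall j, (0 < lam j)%R -> dom_annih (psi j)) /\ mean_num lam psi < +oo.

Definition hoelder_conj p : R := (p / (p - 1))%R.

(* tr(rho^(1/p') a rho^(1/p) a^dagger) and tr(rho^(1/p') a^dagger rho^(1/p) a),
   with p' conjugate to p; since [0 `^ x = 0] for x <> 0, the kernel of rho does
   not contribute. *)
Definition jump_annih p lam psi : \bar R :=
  \sum_(0 <= i <oo) \sum_(0 <= j <oo)
    (lam i `^ (hoelder_conj p)^-1 * lam j `^ p^-1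
     * sqmod (braket (psi i) (annih (psi j))))%:E.
Definition jump_creat p lam psi : \bar R :=
  \sum_(0 <= i <oo) \sum_(0 <= j <oo)
    (lam i `^ (hoelder_conj p)^-1 * lam j `^ p^-1
     * sqmod (braket (psi j) (annih (psi i))))%:E.

(* Expansion of
     (p p'/4) <Gamma^(-1/p')(rho^(1/p')), L^*(Gamma^(-1/p)(rho^(1/p)))>_sigma
   with L^*(X) = e^(-beta/2) ({a a^dagger, X}/2 - a X a^dagger)
                 + e^(beta/2) ({a^dagger a, X}/2 - a^dagger X a). *)
Definition dirichlet_gt1 p lam psi : \bar R :=
  (p * hoelder_conj p / 4)%:E *
  ((expR (- (beta / 2)))%:E *
     (mean_antinum lam psi - (expR (beta / p))%:E * jump_annih p lam psi)
   + (expR (beta / 2))%:E *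
     (mean_num lam psi - (expR (- (beta / p)))%:E * jump_creat p lam psi)).

(* At p = 1 the form is the limit, possibly +oo, as p decreases to 1; values
   p < 1 are not meaningful. *)
Definition dirichlet p lam psi : \bar R :=
  if p == 1%R then lim (dirichlet_gt1 q lam psi @[q --> 1%R^'+])
  else dirichlet_gt1 p lam psi.

Definition thermal_weight (n : nat) : R :=
  ((1 - expR (- beta)) * expR (- (beta * n%:R)))%R.

(* tr(rho log rho) - tr(rho log sigma), where log sigma is diagonal in the Fock
   basis; recall ln 0 = 0. *)
Definition rel_entropy lam psi : \bar R :=
  \sum_(0 <= j <oo) (lam j * ln (lam j))%:E
  - \sum_(0 <= j <oo) (lam j)%:E *
      \sum_(0 <= n <oo) (ln (thermal_weight n) * sqmod (psi j n))%:E.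

End functionals.

(* sigma = (1 - e^(-beta)) e^(-beta a^dagger a); [insubd 0] is harmless since
   the sequence is square summable for beta > 0, see [thermalE]. *)
Definition thermal (R : realType) (beta : R) (u : ell2 R) : ell2 R :=
  insubd 0 (fun n => (thermal_weight beta n)%:C * u n).

Lemma thermalE (R : realType) (beta : R) (u : ell2 R) (n : nat) :
  0 < beta -> thermal beta u n = (thermal_weight beta n)%:C * u n.
Proof.
move=> b0; rewrite /thermal -[LHS]/(val (insubd _ _) n) insubdK//.
have := coefP u; rewrite !unfold_in; apply: le_lt_trans.
apply: lee_nneseries => k _; rewrite lee_fin ?sqmod_ge0// sqmodM.
apply: ler_piMl; first exact: sqmod_ge0.
have e1 : expR (- beta) <= 1 by rewrite -expR0 ler_expR oppr_le0 ltW.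
have ek : expR (- (beta * k%:R)) <= 1.
  by rewrite -expR0 ler_expR oppr_le0 mulr_ge0 // ltW.
have e0 := expR_ge0 (- beta); have ek0 := expR_ge0 (- (beta * k%:R)).
rewrite sqmod_real /thermal_weight exprn_ile1//.
  by rewrite mulr_ge0 ?subr_ge0.
by rewrite mulr_ile1 ?subr_ge0 ?lerBlDr ?lerDl.
Qed.

(* The infimum runs over states together with an eigen-decomposition; the
   functionals do not depend on which eigen-decomposition of rho is used. *)
Definition lsi_const (R : realType) (beta p : R) : \bar R :=
  ereal_inf [set x | exists (rho : ell2 R -> ell2 R)
    (lam : nat -> R) (psi : nat -> ell2 R),
    [/\ state rho, rho <> thermal beta, eigen_decomposition rho lam psi,
        finite_mean_photon lam psi &
        x = (dirichlet beta p lam psi / rel_entropy beta lam psi)%E]].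

Definition sinh (R : realType) (x : R) : R := (expR x - expR (- x)) / 2.

(* Main.v *)
(* Write th = 1/p, f = lam^(1 - th), g = lam^th for the eigenvalues lam of rho and
   m_ij = |<psi_i|a psi_j>|^2, d_j = ||a psi_j||^2 for its eigenvectors. The form is an
   affine function of the two jump sums of m_ij f_i g_j and m_ij g_i f_j, and Bessel's
   inequality together with a a^dagger = a^dagger a + 1 bounds the column sums of m by
   d_j and the row sums by d_i + 1. Under these constraints alone, linear programming
   duality shows that for given eigenvalues the jump sums, relative to the mean photon
   number, are largest when rho is diagonal in the Fock basis with decreasing weights.
   For such a weight sequence with tails T_n, Hoelder's inequality replaces each sum
   over n >= m of lam_n^(1 - th) lam_(n+1)^th by T_m^(1 - th) T_(m+1)^th, and the
   chain rule for the entropy reduces the claim to a single inequality in the ratio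
   T_(m+1) / T_m: the log-Sobolev inequality for a two-point space, in which the
   extremal point is the boundary point q = 1.

   The constant is attained in the limit by thermal states of parameter b -> 0+. For
   p = 1 the form at a fixed state is monotone in p, since cosh is convex as a function
   of the square of its argument, so the limit defining it exists and both bounds pass
   to it. *)
Require Import Defs.
From HB Require Import structures.
From mathcomp Require Import all_boot all_order all_algebra.
From mathcomp Require Import complex.
From mathcomp Require Import all_classical all_reals all_analysis.
From mathcomp Require Import ring lra.
Import Order.TTheory GRing.Theory Num.Theory.
Import numFieldNormedType.Exports.
Local Open Scope classical_set_scope.
Local Open Scope ring_scope.

(** * The two-point inequality *)

(** Everything about jump sums is proved for the first M eigenvalues, in a homogeneous form where
    their sum T stands in place of 1. Such a truncation can be sorted, whereas a full sequence with
    zeros among infinitely many positive terms has no decreasing enumeration. As the eigenvectors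
    need not span the kernel, only Bessel's inequality, not completeness, is available for them. The
    two-point inequality bounds the relative entropy of (1 - q, q) with respect to (1 - w, w), with
    w = e^(-beta). At q = 1 that entropy is beta, which is the beta in the denominator of the
    constant. For a thermal state of parameter b all ratios of consecutive tails equal e^(-b), and
    both the duality bound and Hoelder's inequality are equalities. Only the two-point inequality
    loses something, and it becomes sharp as q = e^(-b) tends to 1. The constant is an infimum of
    ratios, so the denominator has to be strictly positive. This is why the equality case of Klein's
    inequality is worked out. *)

(** Suppose [k q < 0]. For q < w, the mean value theorem used twice gives a negative [k2] left of w,
    while Rolle's theorem between w and 1 gives a zero of [k2] to the right. For q > w, [k] must
    fall after w and climb back to [k 1 = 0], so [k2] is negative first and positive later. Both
    contradict the sign pattern of [k2]. *)
Lemma sign_change_ge0 (R : realType) (k k1 k2 : R -> R) (w : R) :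
  0 < w < 1 ->
  (forall x : R, 0 < x < 1 -> is_derive x 1 k (k1 x)) ->
  (forall x : R, 0 < x < 1 -> is_derive x 1 k1 (k2 x)) ->
  {for (1 : R), continuous k} ->
  k w = 0 -> k1 w = 0 -> k 1 = 0 ->
  (forall x y : R, 0 < x -> x < y -> y < 1 -> k2 x <= 0 -> k2 y < 0) ->
  forall q : R, 0 < q < 1 -> 0 <= k q.
Proof.
move=> /andP[w0 w1] dk dk1 kc1 kw k1w k_1 k2neg q /andP[q0 q1].
have ck x : 0 < x <= 1 -> {for x, continuous k}.
  move=> /andP[x0]; rewrite le_eqVlt => /orP[/eqP->//|x1].
  by apply/differentiable_continuous/derivable1_diffP; have [] := dk x; rewrite ?x0.
have ck1 x : 0 < x < 1 -> {for x, continuous k1}.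
  by move=> x01; apply/differentiable_continuous/derivable1_diffP; have [] := dk1 x.
have mvt a b : 0 < a -> a < b -> b <= 1 ->
    exists2 c, a < c < b & k b - k a = k1 c * (b - a).
  move=> a0 ab b1; have [|||c] := @MVT _ k k1 a b.
  - by [].
  - move=> x; rewrite in_itv/= => /andP[ax xb]; apply: dk.
    by rewrite (lt_trans a0 ax) (lt_le_trans xb b1).
  - apply: continuous_in_subspaceT => x; rewrite inE/= in_itv/= => /andP[ax xb].
    by apply: ck; rewrite (lt_le_trans a0 ax) (le_trans xb b1).
  - by rewrite in_itv/= => cab e; exists c.
have mvt1 a b : 0 < a -> a < b -> b < 1 ->
    exists2 c, a < c < b & k1 b - k1 a = k2 c * (b - a).
  move=> a0 ab b1; have [|||c] := @MVT _ k1 k2 a b.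
  - by [].
  - move=> x; rewrite in_itv/= => /andP[ax xb]; apply: dk1.
    by rewrite (lt_trans a0 ax) (lt_trans xb b1).
  - apply: continuous_in_subspaceT => x; rewrite inE/= in_itv/= => /andP[ax xb].
    by apply: ck1; rewrite (lt_le_trans a0 ax) (le_lt_trans xb b1).
  - by rewrite in_itv/= => cab e; exists c.
rewrite leNgt; apply/negP => kq0.
have [qw|wq|qw] := ltgtP q w; last by rewrite qw kw ltxx in kq0.
- have [x1 /andP[qx1 x1w] e1] := mvt q w q0 qw (ltW w1).
  have [x2 /andP[x12 x2w] e2] := mvt1 x1 w (lt_trans q0 qx1) x1w w1.
  have [y1 /andP[wy1 y11] f1] := mvt w 1 w0 w1 (lexx _).
  have [y2 /andP[wy2 y21] f2] := mvt1 w y1 w0 wy1 y11.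
  have x1p : 0 < k1 x1 by rewrite kw in e1; have : 0 < w - q by [lra]; nra.
  have y10 : k1 y1 = 0.
    move: f1; rewrite kw k_1 subrr => /esym/eqP; rewrite mulf_eq0 => /orP[/eqP//|].
    by rewrite subr_eq0 => /eqP; lra.
  have x2n : k2 x2 <= 0 by rewrite k1w in e2; nra.
  have y2n : k2 y2 < 0 by apply: (k2neg x2) => //; lra.
  by rewrite y10 k1w subrr in f2; have : 0 < y1 - w by [lra]; nra.
- have [x1 /andP[wx1 x1q] e1] := mvt w q w0 wq (ltW q1).
  have [x2 /andP[wx2 x21] e2] := mvt1 w x1 w0 wx1 (lt_trans x1q q1).
  have [y1 /andP[qy1 y11] f1] := mvt q 1 q0 q1 (lexx _).
  have [||y2 /andP[xy2 y21] f2] := mvt1 x1 y1 _ _ y11; try lra.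
  have x1n : k1 x1 < 0 by rewrite kw in e1; have : 0 < q - w by [lra]; nra.
  have y1p : 0 < k1 y1 by rewrite k_1 in f1; nra.
  have x2n : k2 x2 <= 0 by rewrite k1w in e2; nra.
  have y2p : 0 < k2 y2 by nra.
  have : k2 y2 < 0 by apply: (k2neg x2) => //; lra.
  by lra.
Qed.

Lemma continuous_xlnx (R : realType) : continuous (fun x : R => x * ln x).
Proof.
(* This settles continuity at 0, where [ln] is a default value: with s the square root of x,
   [- ln x = 2 * ln s^-1] is at most [2 * s^-1]. *)
have bnd (x : R) : `|x * ln x| <= 2 * Num.sqrt `|x| + `|x| ^+ 2.
  have [x0|x0] := leP x 0.
    by rewrite ln0// mulr0 normr0 addr_ge0 ?mulr_ge0 ?sqrtr_ge0 ?sqr_ge0.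
  set s := Num.sqrt `|x|; have s0 : 0 < s by rewrite sqrtr_gt0 normr_gt0 gt_eqF.
  have xE : x = s ^+ 2 by rewrite sqr_sqrtr// gtr0_norm.
  rewrite normrM (gtr0_norm x0).
  have l1 : ln x <= x by apply/ltW/ln_sublinear.
  have l2 : - ln x <= 2 * s^-1.
    have -> : ln x = 2 * ln s by rewrite xE lnXn// mulr_natl.
    rewrite -mulrN ler_pM2l// -lnV ?posrE//.
    by apply/ltW/ln_sublinear; rewrite invr_gt0.
  have xs : x * s^-1 = s by rewrite {1}xE expr2 mulfK// gt_eqF.
  have [lx|lx] := leP 0 (ln x).
    by rewrite ger0_norm//; nra.
  rewrite ltr0_norm//.
  have : x * - ln x <= x * (2 * s^-1) by rewrite ler_pM2l.
  by rewrite mulrCA xs; nra.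
move=> x; have [x0|x0|->] := ltgtP x 0.
- apply: (@near_cst_continuous _ _ 0); near=> y.
  by rewrite ln0 ?mulr0//; apply: ltW; near: y; exact: lt_nbhsl.
- by apply: cvgM => //; exact: continuous_ln.
- rewrite /prop_for/continuous_at/= mul0r.
  apply: (@norm_cvg0 _ _ _ (nbhs (0 : R)) _ (fun y : R => y * ln y)).
  have h : 2 * Num.sqrt `|y| + `|y| ^+ 2 @[y --> (0 : R)] --> (0 : R).
    have e0 : (0 : R) = 2 * Num.sqrt `|0 : R| + `|0 : R| * `|0 : R|.
      by rewrite normr0 sqrtr0 mul0r mulr0 addr0.
    have n0 : `|y| @[y --> (0 : R)] --> `|0 : R| by exact: norm_continuous.
    rewrite {2}e0; under eq_fun do rewrite expr2.
    apply: cvgD; last exact: (cvgM n0 n0).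
    apply: cvgM; first exact: cvg_cst.
    by apply: continuous_cvg n0; exact: sqrt_continuous.
  apply: (@squeeze_cvgr R (nbhs (0 : R)) _ R (fun=> 0) _ (fun y => `|y * ln y|)
    _ 0 (cvg_cst _) h).
  by near=> y; rewrite normr_ge0 bnd.
Unshelve. all: by end_near. Qed.

Lemma is_derive_ln1B (R : realType) (x : R) : x < 1 ->
  is_derive x 1 (fun y : R => ln (1 - y)) (- (1 - x)^-1).
Proof.
move=> x1; have d1 : is_derive x 1 (fun y : R => 1 - y) (-1).
  by apply: is_derive_eq; rewrite add0r mul1r.
have d2 : is_derive (1 - x) 1 (@ln R) (1 - x)^-1 by apply: is_derive1_ln; lra.
by have := @is_derive1_comp _ (@ln R) (fun y => 1 - y) x _ _ d2 d1; rewrite mulrN1.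
Qed.

Lemma lt_powRN (R : realType) (r x y : R) : r < 0 -> 0 < x -> x < y ->
  y `^ r < x `^ r.
Proof.
move=> r0 x0 xy; have y0 := lt_trans x0 xy.
by rewrite /powR !gt_eqF// ltr_expR ltr_nM2l// ltr_ln ?posrE.
Qed.

(* Both sides vanish to second order at [q = w] and agree at [q = 1]. The second
   derivative of their difference changes sign only once, from + to -. *)
Lemma two_level_lsi (R : realType) (th w q : R) :
  0 < th < 1 -> 0 < w < 1 -> 0 <= q <= 1 ->
  (1 - w `^ th) * (1 - w `^ (1 - th)) / (- ln w) *
    (q * ln q + (1 - q) * ln (1 - q) - (1 - q) * ln (1 - w) - q * ln w)
  <= q + w - q `^ th * w `^ (1 - th) - q `^ (1 - th) * w `^ th.
Proof.
move=> /andP[th0 th1] w01 /andP[q0 q1]; have /andP[w0 w1] := w01.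
set C := _ / _; rewrite -subr_ge0.
pose a := w `^ (1 - th); pose b := w `^ th.
have powD (x r s : R) : 0 < x -> x `^ r * x `^ s = x `^ (r + s).
  by move=> x0; rewrite -powRD// (gt_eqF x0) implybT.
have abw : a * b = w by rewrite powD// subrK powRr1// ltW.
have lw0 : ln w < 0 by rewrite ln_lt0.
pose k (x : R) : R := x + w - x `^ th * a - x `^ (1 - th) * b
  - C * (x * ln x + (1 - x) * ln (1 - x) - (1 - x) * ln (1 - w) - x * ln w).
pose k1 (x : R) : R := 1 - th * x `^ (th - 1) * a - (1 - th) * x `^ (1 - th - 1) * b
  - C * (ln x - ln (1 - x) + ln (1 - w) - ln w).
pose k2 (x : R) : R := th * (1 - th) * x `^ (th - 1 - 1) * a
  + (1 - th) * th * x `^ (1 - th - 1 - 1) * b - C * (x^-1 + (1 - x)^-1).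
have dk (x : R) : 0 < x < 1 -> is_derive x 1 k (k1 x).
  move=> /andP[x0 x1]; have dl := is_derive1_ln x0; have dl1 := is_derive_ln1B _ _ x1.
  have dp := @is_derive1_powR _ th _ x0.
  have dp' := @is_derive1_powR _ (1 - th) _ x0.
  apply: is_derive_eq; rewrite /k1 /GRing.scale/=; field; lra.
have dk1 (x : R) : 0 < x < 1 -> is_derive x 1 k1 (k2 x).
  move=> /andP[x0 x1]; have dl := is_derive1_ln x0; have dl1 := is_derive_ln1B _ _ x1.
  have dp := @is_derive1_powR _ (th - 1) _ x0.
  have dp' := @is_derive1_powR _ (1 - th - 1) _ x0.
  apply: is_derive_eq; rewrite /k2 /GRing.scale/=; field; lra.
have kw : k w = 0.
  rewrite /k -/a -/b [b * a]mulrC abw; ring.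
have wa : w `^ (th - 1) * a = 1.
  by rewrite powD// addrC subrKA subrr powRr0.
have wb : w `^ (1 - th - 1) * b = 1.
  by rewrite powD// addrAC subrK subrr powRr0.
have k1w : k1 w = 0.
  by rewrite /k1 -!mulrA wa wb; ring.
(* This is the origin of [C]: because [a * b = w], the inequality at q = 1 reads
   [C * - ln w <= (1 - a) * (1 - b)], and [C] is the largest constant satisfying it. *)
have k_1 : k 1 = 0.
  rewrite /k !powR1 ln1 subrr ln0// /C -/a -/b.
  rewrite -{1}abw; field; lra.
have kpos (x : R) : 0 < x < 1 -> 0 <= k x.
  apply: (@sign_change_ge0 _ k k1 k2 w) => //.
    rewrite /k; apply: cvgB; last first.
      apply: cvgM; first exact: cvg_cst.
      apply: cvgB; last by apply: cvgM => //; exact: cvg_cst.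
      apply: cvgB; last first.
        by apply: cvgM; [apply: cvgB => //; exact: cvg_cst|exact: cvg_cst].
      apply: cvgD; first exact: continuous_xlnx.
      apply: (@continuous_comp _ _ _ (fun x : R => 1 - x) (fun x => x * ln x)).
        by apply: cvgB => //; exact: cvg_cst.
      exact: continuous_xlnx.
    have cp (r : R) : {for (1 : R), continuous (fun x : R => x `^ r)}.
      apply/differentiable_continuous/derivable1_diffP.
      by have [] := @is_derive1_powR _ r 1 ltr01.
    apply: cvgB; last by apply: cvgM; [exact: cp|exact: cvg_cst].
    apply: cvgB; last by apply: cvgM; [exact: cp|exact: cvg_cst].
    by apply: cvgD => //; exact: cvg_cst.
  move=> {}x y x0 xy y1.
  have x1 := lt_trans xy y1; have y0 := lt_trans x0 xy.
  (* Multiplication by z (1 - z) > 0 turns [k2] into a strictly decreasing function minus [C]; once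
     nonpositive, it is negative from there on. *)
  have k2E (z : R) : 0 < z -> z < 1 -> k2 z * (z * (1 - z)) =
      th * (1 - th) * (1 - z) * (a * z `^ (th - 1) + b * z `^ (1 - th - 1)) - C.
    move=> z0 z1.
    have zB (r : R) : z `^ (r - 1) = z `^ r / z.
      by rewrite powRB ?powRr1 ?ltW// (gt_eqF z0) implybT.
    rewrite /k2 (zB (th - 1)) (zB (1 - th - 1)); field; lra.
  have Ux : y `^ (th - 1) < x `^ (th - 1) by apply: lt_powRN => //; lra.
  have Vx : y `^ (1 - th - 1) < x `^ (1 - th - 1) by apply: lt_powRN => //; lra.
  have U0 : 0 < y `^ (th - 1) by rewrite powR_gt0.
  have V0 : 0 < y `^ (1 - th - 1) by rewrite powR_gt0.
  have a0 : 0 < a by rewrite powR_gt0.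
  have b0 : 0 < b by rewrite powR_gt0.
  have S : (1 - y) * (a * y `^ (th - 1) + b * y `^ (1 - th - 1)) <
      (1 - x) * (a * x `^ (th - 1) + b * x `^ (1 - th - 1)).
    apply: ltr_pM; try lra.
    - by rewrite addr_ge0// mulr_ge0// ltW.
    - by rewrite ltrD// ltr_pM2l.
  have S2 : th * (1 - th) * (1 - y) * (a * y `^ (th - 1) + b * y `^ (1 - th - 1)) <
      th * (1 - th) * (1 - x) * (a * x `^ (th - 1) + b * x `^ (1 - th - 1)).
    by rewrite -2!(mulrA (th * (1 - th))) ltr_pM2l// mulr_gt0// subr_gt0.
  move=> kx; have := k2E x x0 x1; have := k2E y y0 y1.
  have xx : 0 < x * (1 - x) by rewrite mulr_gt0// subr_gt0.
  have yy : 0 < y * (1 - y) by rewrite mulr_gt0// subr_gt0.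
  by nra.
rewrite -/a -/b -/(k q); case: (ltgtP q 1) q1 => // [q1 _|-> _]; last by rewrite k_1.
case: (ltgtP q 0) q0 => // [q0 _|-> _]; first by apply: kpos; rewrite q0.
(* The endpoint q = 0 lies outside the open interval of [kpos] and is reached by continuity from the
   right. *)
have c0 : k x @[x --> (0:R)^'+] --> k 0.
  have cx : x @[x --> (0:R)^'+] --> (0 : R) by apply: cvg_at_right_filter; exact: cvg_id.
  have cxl : x * ln x @[x --> (0:R)^'+] --> (0 * ln 0 : R).
    by apply: cvg_at_right_filter; exact: continuous_xlnx.
  have cxl1 : (1 - x) * ln (1 - x) @[x --> (0:R)^'+] --> ((1 - 0) * ln (1 - 0) : R).
    apply: cvg_at_right_filter.
    apply: (@continuous_comp _ _ _ (fun x : R => 1 - x) (fun x => x * ln x)).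
      by apply: cvgB => //; exact: cvg_cst.
    exact: continuous_xlnx.
  rewrite /k; apply: cvgB.
    apply: cvgB; last first.
      apply: cvgM; last exact: cvg_cst.
      by rewrite powR0 ?subr_eq0 ?gt_eqF//; apply: powR_cvg0; rewrite subr_gt0.
    apply: cvgB; last first.
      by apply: cvgM; [rewrite powR0 ?gt_eqF//; exact: powR_cvg0|exact: cvg_cst].
    by apply: cvgD => //; exact: cvg_cst.
  apply: cvgM; first exact: cvg_cst.
  apply: cvgB; last by apply: cvgM => //; exact: cvg_cst.
  apply: cvgB; last first.
    by apply: cvgM; [apply: cvgB => //; exact: cvg_cst|exact: cvg_cst].
  exact: cvgD.
rewrite -(cvg_lim _ c0)//; apply: limr_ge; first by apply/cvg_ex; exists (k 0).
by near=> x; apply: kpos; apply/andP; split; near: x;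
  [exact: nbhs_right_gt|exact: nbhs_right_lt].
Unshelve. all: by end_near. Qed.

(** * Weight sequences: duality, Hoelder and the entropy chain rule *)

(* e^(-beta/2) e^(beta/p) for [th = 1/p]: the weight of the first jump sum in the
   Dirichlet form; the second one carries its inverse. *)
Definition skew (R : realType) (beta th : R) : R := expR (beta * (th - 2^-1)).

(* 4 alpha_p / (p p'), with [th = 1/p] and p' conjugate to p. *)
Definition lsi_rate (R : realType) (beta th : R) : R :=
  (expR (beta / 2) + expR (- (beta / 2)) - skew _ beta th - (skew _ beta th)^-1)
  / beta.

Lemma skew_gt0 (R : realType) (beta th : R) : 0 < skew _ beta th.
Proof. exact: expR_gt0. Qed.

(** This is [two_level_lsi] at w = e^(-beta) and q = t / T, multiplied by e^(beta/2) T. The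
    homogeneous form lets it be added up over tails T of arbitrary mass. *)
Lemma two_level_lsi_hom (R : realType) (beta th t T : R) :
  0 < beta -> 0 < th < 1 -> 0 <= t <= T ->
  skew _ beta th * (T `^ (1 - th) * t `^ th - t)
  + (skew _ beta th)^-1 * (T `^ th * t `^ (1 - th) - t)
  <= lsi_rate _ beta th * (T * ln T - t * ln t - (T - t) * ln (T - t))
     + (lsi_rate _ beta th * ln (1 - expR (- beta)) + expR (- (beta / 2))) * (T - t).
Proof.
move=> b0 th01 /andP[t0 tT]; have /andP[th0 th1] := th01.
have := le_trans t0 tT; rewrite le_eqVlt => /orP[/eqP T0|T0].
  have -> : t = 0 by apply/eqP; rewrite eq_le t0 T0 tT.
  by rewrite -T0 !powR0 ?gt_eqF ?subr_gt0// !(mul0r, mulr0, subrr, addr0).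
pose q := t / T; have q0 : 0 <= q by rewrite divr_ge0// ltW.
have q1 : q <= 1 by rewrite ler_pdivrMr// mul1r.
have tE : t = q * T by rewrite divfK// gt_eqF.
have w01 : 0 < expR (- beta) < 1 by rewrite expR_gt0 -expR0 ltr_expR oppr_lt0.
have := @two_level_lsi _ th (expR (- beta)) q th01 w01; rewrite q0 q1 => /(_ isT).
rewrite -!expRM expRK opprK; set k := skew _ _ _; set e := expR (beta / 2).
set l := ln (1 - expR _); set c := lsi_rate _ _ _.
have e0 : 0 < e by exact: expR_gt0.
have k0 : 0 < k by exact: skew_gt0.
have eN : expR (- (beta / 2)) = e^-1 by rewrite expRN.
have wE : expR (- beta) = e^-1 * e^-1 by rewrite -eN -expRD; congr expR; lra.
have w1E : expR (- beta * (1 - th)) = e^-1 * k by rewrite -eN -expRD; congr expR; lra.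
have wtE : expR (- beta * th) = e^-1 * k^-1.
  by rewrite -eN -expRN -expRD; congr expR; lra.
have cE : e + e^-1 - k - k^-1 = c * beta by rewrite /c /lsi_rate eN divfK// gt_eqF.
rewrite w1E wtE wE eN.
have -> : (1 - e^-1 * k^-1) * (1 - e^-1 * k) / beta = e^-1 * c.
  apply: (@mulIf _ beta); first by rewrite gt_eqF.
  by rewrite divfK ?gt_eqF// -mulrA -cE; field; lra.
have lT : T * ln T - t * ln t - (T - t) * ln (T - t)
    = - T * (q * ln q + (1 - q) * ln (1 - q)).
  have TtE : T - t = (1 - q) * T by rewrite tE; ring.
  have xM (x : R) : 0 <= x -> (x * T) * ln (x * T) = T * (x * ln x) + x * (T * ln T).
    rewrite le_eqVlt => /orP[/eqP<-|x0]; first by rewrite !mul0r mulr0 addr0.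
    by rewrite lnM ?posrE//; ring.
  by rewrite TtE tE !xM ?subr_ge0//; ring.
have PT (r : R) : T * q `^ r = T `^ (1 - r) * t `^ r.
  rewrite tE powRM ?(ltW T0)// mulrCA -powRD ?(gt_eqF T0) ?implybT//.
  by rewrite subrK powRr1 1?mulrC// ltW.
have -> : T `^ th * t `^ (1 - th) = T * q `^ (1 - th).
  by rewrite PT; congr (_ `^ _ * _); lra.
rewrite -PT lT => H.
have {}H := ler_wpM2l (ltW (mulr_gt0 e0 T0)) H.
have E1 : e * T * (e^-1 * c * (q * ln q + (1 - q) * ln (1 - q) - (1 - q) * l - q * - beta))
   = T * (c * (q * ln q + (1 - q) * ln (1 - q) - (1 - q) * l) + (e + e^-1 - k - k^-1) * q).
  by rewrite cE; field; lra.
have E2 : e * T * (q + e^-1 / e - q `^ th * (e^-1 * k) - q `^ (1 - th) * (e^-1 / k))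
  = T * (e * q + e^-1 - k * q `^ th - k^-1 * q `^ (1 - th)) by field; lra.
rewrite E1 E2 in H; rewrite tE -subr_ge0.
by move: H; rewrite -subr_ge0; congr (0 <= _); ring.
Qed.

(** Induction on the number of terms, from the two-term inequality with exponents 1 / (1 - th) and 1
    / th. *)
Lemma hoelder_sum (R : realType) (th : R) (m M : nat) (a b : nat -> R) :
  0 < th < 1 -> (forall i, 0 <= a i) -> (forall i, 0 <= b i) ->
  \sum_(m <= i < M) a i `^ (1 - th) * b i `^ th
  <= (\sum_(m <= i < M) a i) `^ (1 - th) * (\sum_(m <= i < M) b i) `^ th.
Proof.
move=> /andP[th0 th1] a0 b0.
have th1' : 0 < 1 - th by rewrite subr_gt0.
have H2 (x y z u : R) : 0 <= x -> 0 <= y -> 0 <= z -> 0 <= u ->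
    x `^ (1 - th) * y `^ th + z `^ (1 - th) * u `^ th
    <= (x + z) `^ (1 - th) * (y + u) `^ th.
  move=> x0 y0 z0 u0.
  have := @hoelder2 _ (x `^ (1 - th)) (z `^ (1 - th)) (y `^ th) (u `^ th)
    (1 - th)^-1 th^-1.
  rewrite -!powRrM !mulfV ?gt_eqF// !powRr1// !invrK; apply; rewrite ?powR_ge0 ?invr_gt0//.
  by rewrite subrK.
elim: M => [|M IH]; first by rewrite !big_geq// !powR0 ?gt_eqF// mulr0.
have [mM|Mm] := leqP m M; last first.
  by rewrite !big_geq// !powR0 ?gt_eqF// mulr0.
rewrite !big_nat_recr//=; apply: le_trans (H2 _ _ _ _ _ _ _ _) => //.
- by rewrite lerD2r.
- exact: sumr_ge0.
- exact: sumr_ge0.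
Qed.

(* Linear programming duality: [al] and [ga] are dual certificates for the row
   and column constraints, complementary to the Fock configuration in which
   [m i j] vanishes unless [j = i.+1] and [m i i.+1 = i.+1]. *)
Lemma jump_duality (R : realType) (M : nat) (f g d : nat -> R) (m : nat -> nat -> R) :
  (forall i j, (i <= j)%N -> f j <= f i) -> (forall i j, (i <= j)%N -> g j <= g i) ->
  f M = 0 -> g M = 0 -> (forall i j, 0 <= m i j) ->
  (forall j, (j < M)%N -> \sum_(0 <= i < M) m i j <= d j) ->
  (forall i, (i < M)%N -> \sum_(0 <= j < M) m i j <= d i + 1) ->
  \sum_(0 <= i < M) \sum_(0 <= j < M) f i * g j * m i j
  <= \sum_(0 <= j < M) f j * g j * d j
     + \sum_(0 <= n < M) \sum_(n <= k < M) g k.+1 * (f k - f k.+1).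
Proof.
move=> fd gd fM gM m0 col row.
have f0 i : (i <= M)%N -> 0 <= f i by move=> /fd; rewrite fM.
have g0 i : (i <= M)%N -> 0 <= g i by move=> /gd; rewrite gM.
(* These values are forced by [al n + ga n = f n * g n], which makes [f n * g n] the coefficient of
   [d n], by equality in [f i * g j <= al i + ga j] at [j = i.+1], and by [al M = 0]. *)
pose al n := \sum_(n <= k < M) g k.+1 * (f k - f k.+1).
pose ga n := f n * g n - al n.
have al0 n : 0 <= al n.
  rewrite /al big_nat_cond; apply: sumr_ge0 => k /andP[/andP[_ kM] _].
  by rewrite mulr_ge0 ?g0// subr_ge0 fd.
have alB i j : (i <= j)%N -> (j <= M)%N ->
    al i = \sum_(i <= k < j) g k.+1 * (f k - f k.+1) + al j.
  by move=> ij jM; rewrite /al (big_cat_nat ij jM).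
have tel i j : (i <= j)%N -> \sum_(i <= k < j) (f k - f k.+1) = f i - f j.
  by move=> ij; rewrite -[RHS]opprB -telescope_sumr// -sumrN;
    under [RHS]eq_bigr do rewrite opprB.
(* The difference [al i - al j] sums the decrements of [f] weighted by values of [g] at indices from
   [i.+1] to [j]; as [g] decreases, it lies between [g j] and [g i] times the total decrement. *)
have lb i j : (i <= j)%N -> (j <= M)%N -> g j * (f i - f j) <= al i - al j.
  move=> ij jM; rewrite (alB _ _ ij jM) addrK -tel// mulr_sumr.
  rewrite big_nat_cond [leRHS]big_nat_cond; apply: ler_sum => k /andP[/andP[_ kj] _].
  by rewrite ler_wpM2r// ?subr_ge0 ?fd// gd.
have ub i j : (i <= j)%N -> (j <= M)%N -> al i - al j <= g i * (f i - f j).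
  move=> ij jM; rewrite (alB _ _ ij jM) addrK -tel// mulr_sumr.
  rewrite big_nat_cond [leRHS]big_nat_cond; apply: ler_sum => k /andP[/andP[ik _] _].
  by rewrite ler_wpM2r// ?subr_ge0 ?fd// gd// ltnW.
have alM : al M = 0 by rewrite /al big_geq.
have ga0 n : (n < M)%N -> 0 <= ga n.
  move=> nM; rewrite subr_ge0; have := ub n M (ltnW nM) (leqnn _).
  by rewrite alM fM !subr0 mulrC.
have cert i j : (i < M)%N -> (j < M)%N -> f i * g j <= al i + ga j.
  move=> iM jM; rewrite /ga; have [ij|ji] := leqP i j.
    by have := lb i j ij (ltnW jM); lra.
  by have := ub j i (ltnW ji) (ltnW iM); lra.
apply: (@le_trans _ _ (\sum_(0 <= i < M) \sum_(0 <= j < M) (al i * m i j + ga j * m i j))).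
  rewrite big_nat_cond [leRHS]big_nat_cond; apply: ler_sum => i /andP[/andP[_ iM] _].
  rewrite big_nat_cond [leRHS]big_nat_cond; apply: ler_sum => j /andP[/andP[_ jM] _].
  by rewrite -mulrDl ler_wpM2r// cert.
under eq_bigr do rewrite big_split/=.
rewrite big_split/= [X in _ + X]exchange_big/= -big_split/=.
rewrite -big_split/= big_nat_cond [leRHS]big_nat_cond.
apply: ler_sum => n /andP[/andP[_ nM] _].
rewrite -2!mulr_sumr -/(al n); have := ler_wpM2l (al0 n) (row n nM).
have := ler_wpM2l (ga0 n nM) (col n nM); rewrite /ga; lra.
Qed.

Lemma jump_bound_sorted (R : realType) (beta th : R) (M : nat)
    (lam d : nat -> R) (m : nat -> nat -> R) :
  0 < beta -> 0 < th < 1 ->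
  (forall i j, (i <= j)%N -> lam j <= lam i) -> (forall i, (M <= i)%N -> lam i = 0) ->
  (forall i j, 0 <= m i j) ->
  (forall j, (j < M)%N -> \sum_(0 <= i < M) m i j <= d j) ->
  (forall i, (i < M)%N -> \sum_(0 <= j < M) m i j <= d i + 1) ->
  forall T : R, T = \sum_(0 <= i < M) lam i ->
  skew _ beta th * (\sum_(0 <= i < M) \sum_(0 <= j < M)
     lam i `^ (1 - th) * lam j `^ th * m i j)
  + (skew _ beta th)^-1 * (\sum_(0 <= i < M) \sum_(0 <= j < M)
     lam i `^ th * lam j `^ (1 - th) * m i j)
  <= (skew _ beta th + (skew _ beta th)^-1) * (\sum_(0 <= j < M) lam j * d j)
     + lsi_rate _ beta th * (T * ln T - \sum_(0 <= i < M) lam i * ln (lam i))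
     + (lsi_rate _ beta th * ln (1 - expR (- beta)) + expR (- (beta / 2))) * T.
Proof.
move=> b0 th01 lamd lamM m0 col row T TE; have /andP[th0 th1] := th01.
have lam0 i : 0 <= lam i.
  by have [/ltnW iM|/lamM->//] := ltnP i M; rewrite -(lamM M) ?lamd.
have th1' : 0 < 1 - th by rewrite subr_gt0.
have powd r : 0 < r -> forall i j, (i <= j)%N -> lam j `^ r <= lam i `^ r.
  by move=> r0 i j ij; rewrite ge0_ler_powR ?nnegrE ?lamd// ltW.
have powM r : 0 < r -> lam M `^ r = 0 by move=> r0; rewrite lamM// powR0 ?gt_eqF.
have powMM r n : 0 < r -> r < 1 -> lam n `^ r * lam n `^ (1 - r) = lam n.
  move=> r0 r1; have [->|l0] := eqVneq (lam n) 0.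
    by rewrite powR0 ?mul0r ?gt_eqF.
  by rewrite -powRD ?l0 ?implybT// addrC subrK powRr1.
pose tl n := \sum_(n <= k < M) lam k.
have tl0 n : 0 <= tl n by exact: sumr_ge0.
have tlS n : (n < M)%N -> tl n = lam n + tl n.+1 by move=> nM; rewrite /tl big_ltn.
have tlM : tl M = 0 by rewrite /tl big_geq.
have tlsh n : (n < M)%N -> \sum_(n <= k < M) lam k.+1 = tl n.+1.
  move=> nM; rewrite /tl -(big_add1 _ _ n M.+1 xpredT lam) [RHS]/=.
  by rewrite big_nat_recr//= lamM// addr0.
(* With f = lam^(1 - r) and g = lam^r, the certificate [al n] is the sum over k >= n of lam_k^(1 -
   r) lam_(k+1)^r - lam_(k+1). The exponents r = th and r = 1 - th give the two jump sums. *)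
have dual r : 0 < r -> r < 1 ->
    \sum_(0 <= i < M) \sum_(0 <= j < M) lam i `^ (1 - r) * lam j `^ r * m i j
    <= \sum_(0 <= j < M) lam j * d j
       + \sum_(0 <= n < M) (tl n `^ (1 - r) * tl n.+1 `^ r - tl n.+1).
  move=> r0 r1; have r1' : 0 < 1 - r by rewrite subr_gt0.
  have := @jump_duality _ M (fun i => lam i `^ (1 - r)) (fun i => lam i `^ r) d m
    (powd _ r1') (powd _ r0) (powM _ r1') (powM _ r0) m0 col row.
  move=> /le_trans; apply; apply: lerD.
    by apply: ler_sum => j _; rewrite [_ * lam j `^ _]mulrC powMM.
  rewrite big_nat_cond [leRHS]big_nat_cond; apply: ler_sum => n /andP[/andP[_ nM] _].
  under eq_bigr do rewrite mulrBr powMM// mulrC.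
  rewrite sumrB tlsh// lerD2r -tlsh//.
  by apply: hoelder_sum => //; rewrite r0.
have D1 := dual th th0 th1.
have := dual (1 - th) th1'; rewrite subKr => /(_ _)D2.
have {}D2 := D2 ltac:(lra).
have k0 := skew_gt0 _ beta th; set k := skew _ _ _ in k0 *.
have {}D1 := ler_wpM2l (ltW k0) D1.
have ki0 : 0 < k^-1 by rewrite invr_gt0.
have {}D2 := ler_wpM2l (ltW ki0) D2.
apply: le_trans (lerD D1 D2) _.
set A := _ * ln (1 - _) + _; set c := lsi_rate _ _ _; set L := \sum_(0 <= j < M) lam j * d j.
suff H : k * \sum_(0 <= n < M) (tl n `^ (1 - th) * tl n.+1 `^ th - tl n.+1)
    + k^-1 * \sum_(0 <= n < M) (tl n `^ th * tl n.+1 `^ (1 - th) - tl n.+1)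
    <= c * (T * ln T - \sum_(0 <= i < M) lam i * ln (lam i)) + A * T by lra.
(* Chain rule for the entropy: each tail [tl n] is cut into [lam n] and [tl n.+1], so the claim
   splits into one instance of [two_level_lsi_hom] per n. *)
have -> : T * ln T = \sum_(0 <= n < M) (tl n * ln (tl n) - tl n.+1 * ln (tl n.+1)).
  have -> : T = tl 0%N by rewrite TE.
  rewrite (telescope_sumr_eq (fun n => - (tl n * ln (tl n)))) ?leq0n//.
    by rewrite tlM mul0r oppr0 sub0r opprK.
  by move=> n _; rewrite opprK addrC.
rewrite TE -sumrB !mulr_sumr -!big_split/=.
rewrite big_nat_cond [leRHS]big_nat_cond; apply: ler_sum => n /andP[/andP[_ nM] _].
have lamE : lam n = tl n - tl n.+1 by rewrite tlS// addrK.
have tt : 0 <= tl n.+1 <= tl n by rewrite tl0 (tlS n nM) lerDr lam0.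
have := @two_level_lsi_hom _ beta th (tl n.+1) (tl n) b0 th01 tt.
rewrite -lamE -/k -/c -/A; lra.
Qed.

(** Hypotheses and conclusion are invariant under a common permutation of the first M indices, so
    the weights may be taken in decreasing order. *)
Lemma jump_bound (R : realType) (beta th : R) (M : nat)
    (lam d : nat -> R) (m : nat -> nat -> R) :
  0 < beta -> 0 < th < 1 ->
  (forall i, 0 <= lam i) -> (forall i j, 0 <= m i j) ->
  (forall j, (j < M)%N -> \sum_(0 <= i < M) m i j <= d j) ->
  (forall i, (i < M)%N -> \sum_(0 <= j < M) m i j <= d i + 1) ->
  forall T : R, T = \sum_(0 <= i < M) lam i ->
  skew _ beta th * (\sum_(0 <= i < M) \sum_(0 <= j < M)
     lam i `^ (1 - th) * lam j `^ th * m i j)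
  + (skew _ beta th)^-1 * (\sum_(0 <= i < M) \sum_(0 <= j < M)
     lam i `^ th * lam j `^ (1 - th) * m i j)
  <= (skew _ beta th + (skew _ beta th)^-1) * (\sum_(0 <= j < M) lam j * d j)
     + lsi_rate _ beta th * (T * ln T - \sum_(0 <= i < M) lam i * ln (lam i))
     + (lsi_rate _ beta th * ln (1 - expR (- beta)) + expR (- (beta / 2))) * T.
Proof.
move=> b0 th01 lam0 m0 col row T TE; rewrite {}TE {T}.
pose r := [rel i j : nat | lam j <= lam i].
pose s := sort r (iota 0 M).
have sM : size s = M by rewrite size_sort size_iota.
have sP : perm_eq s (iota 0 M) by rewrite perm_sort.
pose t n := nth 0%N s n.
have tM n : (n < M)%N -> (t n < M)%N.
  by move=> nM; have := mem_nth 0%N (s := s) (n := n);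
    rewrite sM => /(_ nM); rewrite (perm_mem sP) mem_iota.
have sumE (F : nat -> R) : \sum_(0 <= i < M) F i = \sum_(0 <= i < M) F (t i).
  by rewrite {1}/index_iota subn0 -(perm_big _ sP) (big_nth 0%N) sM.
have cong (F G : nat -> R) : (forall i, (i < M)%N -> F i = G i) ->
    \sum_(0 <= i < M) F i = \sum_(0 <= i < M) G i.
  by move=> FG; apply: eq_big_nat => i /andP[_ /FG].
(* Padding by 0 keeps the sorted sequence decreasing and provides the value 0 at index M on which
   the dual certificates rely. *)
pose lam' n := if (n < M)%N then lam (t n) else 0.
have lamE n : (n < M)%N -> lam (t n) = lam' n by rewrite /lam' => ->.
have r_tr : transitive r by move=> x y z /= h1 h2; exact: le_trans h2 h1.
have r_tot : total r by move=> x y; exact: le_total.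
have sS : sorted r s by exact: sort_sorted.
have lamd i j : (i <= j)%N -> lam' j <= lam' i.
  rewrite /lam'; have [jM ij|_ _] := ltnP j M; last by case: ifP.
  rewrite (leq_ltn_trans ij jM).
  have := sorted_leq_nth r_tr _ 0%N sS; apply => //.
  - by move=> x /=.
  - by rewrite inE sM (leq_ltn_trans ij jM).
  - by rewrite inE sM.
have lamM i : (M <= i)%N -> lam' i = 0 by move=> Mi; rewrite /lam' ltnNge Mi.
have col' j : (j < M)%N -> \sum_(0 <= i < M) m (t i) (t j) <= d (t j).
  by move=> jM; rewrite -(sumE (fun i => m i (t j))) col// tM.
have row' i : (i < M)%N -> \sum_(0 <= j < M) m (t i) (t j) <= d (t i) + 1.
  by move=> iM; rewrite -(sumE (fun j => m (t i) j)) row// tM.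
have H := @jump_bound_sorted _ beta th M lam' (fun n => d (t n))
  (fun i j => m (t i) (t j)) b0 th01 lamd lamM (fun i j => m0 _ _) col' row' _ erefl.
have eT : \sum_(0 <= i < M) lam' i = \sum_(0 <= i < M) lam i.
  by rewrite [RHS]sumE; apply: (cong) => i iM; rewrite lamE.
have eS : \sum_(0 <= i < M) lam' i * ln (lam' i) = \sum_(0 <= i < M) lam i * ln (lam i).
  by rewrite [RHS]sumE; apply: (cong) => i iM; rewrite lamE.
have eD : \sum_(0 <= i < M) lam' i * d (t i) = \sum_(0 <= i < M) lam i * d i.
  by rewrite [RHS]sumE; apply: (cong) => i iM; rewrite lamE.
have eJ (u v : R) : \sum_(0 <= i < M) \sum_(0 <= j < M) lam i `^ u * lam j `^ v * m i j
    = \sum_(0 <= i < M) \sum_(0 <= j < M) lam' i `^ u * lam' j `^ v * m (t i) (t j).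
  rewrite sumE; apply: (cong) => i iM.
  by rewrite sumE; apply: (cong) => j jM; rewrite !lamE.
by move: H; rewrite eT eS eD -!eJ.
Qed.

(** * Sequence space *)

Local Open Scope complex_scope.
Local Open Scope ring_scope.

Lemma eseries_EFin (R : realType) (a : nat -> R) (l : R) :
  series a @ \oo --> l -> (\sum_(0 <= n <oo) (a n)%:E = l%:E)%E.
Proof.
move=> al; have -> : (fun n => \sum_(0 <= i < n) (a i)%:E)%E = EFin \o series a.
  by apply/funext => n; rewrite /series/= sumEFin.
by rewrite EFin_lim ?(cvg_lim _ al)//; apply/cvg_ex; exists l.
Qed.

Lemma nneseries_fin_cvg (R : realType) (a : nat -> R) (l : R) :
  (forall n, 0 <= a n) -> (\sum_(0 <= n <oo) (a n)%:E = l%:E)%E ->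
  series a @ \oo --> l.
Proof.
move=> a0 al; have : (\sum_(0 <= i < n) (a i)%:E)%E @[n --> \oo] --> l%:E.
  by rewrite -al; apply: is_cvg_nneseries => n _ _; rewrite lee_fin.
have -> : (fun n => \sum_(0 <= i < n) (a i)%:E)%E = EFin \o series a.
  by apply/funext => n; rewrite /series/= sumEFin.
exact: fine_cvg.
Qed.

Lemma conjcE (R : realType) (a b : R) : (a +i* b)^* = a -i* b.
Proof. by []. Qed.

Lemma sqmod_conj (R : realType) (z : R[i]) : sqmod z^* = sqmod z.
Proof. by case: z => a b; rewrite conjcE /sqmod /= sqrrN. Qed.

Lemma mul_conjc (R : realType) (z : R[i]) : z^* * z = (sqmod z)%:C.
Proof.
case: z => a b; rewrite conjcE /sqmod; apply/eqP; rewrite eq_complex/=.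
by apply/andP; split; apply/eqP; ring.
Qed.

(** Convergence of both components, in line with [braket]. Identities for [braket] are obtained by
    comparing partial sums and applying [ccvg_unique]. *)
Definition ccvg (R : realType) (s : nat -> R[i]) (l : R[i]) : Prop :=
  (complex.Re (s n) @[n --> \oo] --> complex.Re l)
  /\ (complex.Im (s n) @[n --> \oo] --> complex.Im l).

Lemma ccvg_unique (R : realType) (s : nat -> R[i]) (l l' : R[i]) :
  ccvg _ s l -> ccvg _ s l' -> l = l'.
Proof.
move=> [r i] [r' i']; apply/eqP; rewrite eq_complex.
by rewrite -(cvg_lim _ r)// -(cvg_lim _ i)// -(cvg_lim _ r')// -(cvg_lim _ i')// !eqxx.
Qed.

Lemma ccvgD (R : realType) (s t : nat -> R[i]) (l k : R[i]) :
  ccvg _ s l -> ccvg _ t k -> ccvg _ (fun n => s n + t n) (l + k).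
Proof.
have RD (z w : R[i]) : complex.Re (z + w) = complex.Re z + complex.Re w.
  by case: z w => [a b] [c d].
have ID (z w : R[i]) : complex.Im (z + w) = complex.Im z + complex.Im w.
  by case: z w => [a b] [c d].
move=> [r i] [r' i']; split; rewrite ?RD ?ID.
  by under eq_fun do rewrite RD; exact: cvgD.
by under eq_fun do rewrite ID; exact: cvgD.
Qed.

Lemma ccvgZ (R : realType) (s : nat -> R[i]) (c l : R[i]) :
  ccvg _ s l -> ccvg _ (fun n => c * s n) (c * l).
Proof.
have RM (z w : R[i]) : complex.Re (z * w)
    = complex.Re z * complex.Re w - complex.Im z * complex.Im w.
  by case: z w => [x y] [u v].
have IM (z w : R[i]) : complex.Im (z * w)
    = complex.Re z * complex.Im w + complex.Im z * complex.Re w.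
  by case: z w => [x y] [u v].
move=> [r i]; split; rewrite ?RM ?IM.
  by under eq_fun do rewrite RM; apply: cvgB; apply: cvgMr.
by under eq_fun do rewrite IM; apply: cvgD; apply: cvgMr.
Qed.

Lemma ccvg_conj (R : realType) (s : nat -> R[i]) (l : R[i]) :
  ccvg _ s l -> ccvg _ (fun n => (s n)^*) l^*.
Proof.
have RC (z : R[i]) : complex.Re z^* = complex.Re z by case: z.
have IC (z : R[i]) : complex.Im z^* = - complex.Im z by case: z.
move=> [r i]; split; rewrite ?RC ?IC.
  by under eq_fun do rewrite RC.
by under eq_fun do rewrite IC; exact: cvgN.
Qed.

(** The real-valued counterpart of [sqnorm], meaningful for square summable sequences only. *)
Definition nsq (R : realType) (u : nat -> R[i]) : R :=
  limn (series (fun n => sqmod (u n))).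

Lemma sqnormE (R : realType) (u : nat -> R[i]) : u \in @square_summable R ->
  sqnorm u = (nsq _ u)%:E /\ (series (fun n => sqmod (u n)) @ \oo --> nsq _ u).
Proof.
rewrite unfold_in /square_summable => ufin.
have u0 n : 0 <= sqmod (u n) by exact: sqmod_ge0.
have : sqnorm u \is a fin_num.
  by rewrite ge0_fin_numE//; apply: nneseries_ge0 => n _ _; rewrite lee_fin.
move=> /fineK E; have c := @nneseries_fin_cvg _ _ _ u0 (esym E).
by split; rewrite /nsq (cvg_lim _ c)// E.
Qed.

Lemma nsq_ge0 (R : realType) (u : nat -> R[i]) : u \in @square_summable R ->
  0 <= nsq _ u.
Proof.
move=> us; have [e _] := sqnormE _ _ us.
by rewrite -lee_fin -e; apply: nneseries_ge0 => n _ _; rewrite lee_fin sqmod_ge0.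
Qed.

(** The real and imaginary parts of each term are dominated by [sqmod (u n) + sqmod (v n)], so both
    series converge absolutely. *)
Lemma braket_cvg (R : realType) (u v : nat -> R[i]) :
  u \in @square_summable R -> v \in @square_summable R ->
  ccvg _ (fun N => \sum_(0 <= n < N) (u n)^* * v n) (braket u v).
Proof.
move=> us vs; have [_ cu] := sqnormE _ _ us; have [_ cv] := sqnormE _ _ vs.
have cuv : cvgn (series (fun n => sqmod (u n) + sqmod (v n))).
  apply/cvg_ex; exists (nsq _ u + nsq _ v).
  have -> : series (fun n => sqmod (u n) + sqmod (v n))
      = series (fun n => sqmod (u n)) \+ series (fun n => sqmod (v n)).
    by apply/funext => n; rewrite /series/= big_split.
  exact: cvgD.
have key (h : nat -> R) : (forall n, `|h n| <= sqmod (u n) + sqmod (v n)) ->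
    series h @ \oo --> limn (series h).
  move=> hle; apply: normed_cvg; apply: (series_le_cvg _ _ hle cuv) => n //.
  by rewrite addr_ge0 ?sqmod_ge0.
have RS (f : nat -> R[i]) N : complex.Re (\sum_(0 <= n < N) f n)
    = series (fun n => complex.Re (f n)) N.
  rewrite /series/=; elim: N => [|N IH]; first by rewrite !big_geq.
  by rewrite !big_nat_recr//= -IH; case: (f N) (\sum_(0 <= i < N) f i) => [? ?] [].
have IS (f : nat -> R[i]) N : complex.Im (\sum_(0 <= n < N) f n)
    = series (fun n => complex.Im (f n)) N.
  rewrite /series/=; elim: N => [|N IH]; first by rewrite !big_geq.
  by rewrite !big_nat_recr//= -IH; case: (f N) (\sum_(0 <= i < N) f i) => [? ?] [].
have bd (a b c d : R) : `|a * c + b * d| <= a ^+ 2 + b ^+ 2 + (c ^+ 2 + d ^+ 2).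
  rewrite ler_norml; apply/andP; split.
    by have := sqr_ge0 (a + c); have := sqr_ge0 (b + d);
       have := sqr_ge0 a; have := sqr_ge0 b; have := sqr_ge0 c; have := sqr_ge0 d; nra.
  by have := sqr_ge0 (a - c); have := sqr_ge0 (b - d);
     have := sqr_ge0 a; have := sqr_ge0 b; have := sqr_ge0 c; have := sqr_ge0 d; nra.
split; [under eq_fun do rewrite RS|under eq_fun do rewrite IS]; apply: key => n;
  case: (u n) (v n) => [a b] [c d]; rewrite conjcE /sqmod/=.
  by have := bd a b c d; congr (`| _ | <= _); ring.
by have := bd a (- b) d c; rewrite sqrrN; congr (`| _ | <= _); ring.
Qed.

Lemma braket_linear (R : realType) (u v w : nat -> R[i]) (c : R[i]) :
  u \in @square_summable R -> v \in @square_summable R ->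
  w \in @square_summable R ->
  braket u (c *: v + w) = c * braket u v + braket u w.
Proof.
move=> us vs ws; have cvws : c *: v + w \in @square_summable R.
  by rewrite rpredD ?rpredZ.
apply: (ccvg_unique _ _ _ _ (braket_cvg _ _ _ us cvws)).
have := ccvgD _ _ _ _ _ (ccvgZ _ _ c _ (braket_cvg _ _ _ us vs)) (braket_cvg _ _ _ us ws).
congr (ccvg _ _ _); apply/funext => N; rewrite mulr_sumr -big_split/=.
by apply: eq_bigr => n _; rewrite mulrCA -mulrDr.
Qed.

Lemma braketC (R : realType) (u v : nat -> R[i]) :
  u \in @square_summable R -> v \in @square_summable R ->
  braket v u = (braket u v)^*.
Proof.
move=> us vs; apply: (ccvg_unique _ _ _ _ (braket_cvg _ _ _ vs us)).
have := ccvg_conj _ _ _ (braket_cvg _ _ _ us vs).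
congr (ccvg _ _ _); apply/funext => N; rewrite rmorph_sum/=.
by apply: eq_bigr => n _; rewrite rmorphM/= conjCK mulrC.
Qed.

Lemma braket_self (R : realType) (u : nat -> R[i]) :
  u \in @square_summable R -> braket u u = (nsq _ u)%:C.
Proof.
move=> us; apply: (ccvg_unique _ _ _ _ (braket_cvg _ _ _ us us)).
have [_ cu] := sqnormE _ _ us.
have -> : (fun N => \sum_(0 <= n < N) (u n)^* * u n)
    = (fun N => (series (fun n => sqmod (u n)) N)%:C).
  by apply/funext => N; rewrite /series/= rmorph_sum/=; apply: eq_bigr => n _; rewrite mul_conjc.
by split => //=; exact: cvg_cst.
Qed.

Lemma nsq_sub (R : realType) (u v : nat -> R[i]) (c : R[i]) :
  u \in @square_summable R -> v \in @square_summable R ->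
  nsq _ (v - c *: u)
  = nsq _ v - 2 * complex.Re (c^* * braket u v) + sqmod c * nsq _ u.
Proof.
move=> us vs; set w := v - c *: u.
have wE : w = (- c) *: u + v by rewrite scaleNr addrC.
have ws : w \in @square_summable R by rewrite rpredB ?rpredZ.
have e1 : braket w w = (- c) * (braket u w)^* + (braket v w)^*.
  by rewrite {2}wE braket_linear// -(braketC _ u w)// -(braketC _ v w).
have e2 : braket u w = (- c) * (nsq _ u)%:C + braket u v.
  by rewrite wE braket_linear// braket_self.
have e3 : braket v w = (- c) * (braket u v)^* + (nsq _ v)%:C.
  by rewrite wE braket_linear// braket_self// -braketC.
have := e1; rewrite braket_self// e2 e3; move: (nsq _ w) (braket u v) => nw z.
case: z c {w wE ws e1 e2 e3} => [a b] [x y] /(congr1 (@complex.Re R)).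
by rewrite !rmorphD !rmorphM !rmorphN/= /sqmod/= => ->; ring.
Qed.

(** The vectors are subtracted one at a time. The remainder keeps its component along every later
    [psi k], so each step lowers [nsq] by exactly one squared coefficient. *)
Lemma orthonormal_expansion (R : realType) (psi : nat -> ell2 R) (v : nat -> R[i]) (M : nat) :
  (forall i j, braket (psi i) (psi j) = (i == j)%:R) ->
  v \in @square_summable R ->
  v - \sum_(j < M) braket (psi j) v *: (psi j : nat -> R[i]) \in @square_summable R
  /\ nsq _ (v - \sum_(j < M) braket (psi j) v *: (psi j : nat -> R[i]))
     = nsq _ v - \sum_(0 <= j < M) sqmod (braket (psi j) v).
Proof.
move=> on vs; have ps j : (psi j : nat -> R[i]) \in @square_summable R by exact: coefP.
have n1 j : nsq _ (psi j) = 1.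
  by have := braket_self _ _ (ps j); rewrite on eqxx => -[].
pose r N := v - \sum_(j < N) braket (psi j) v *: (psi j : nat -> R[i]).
have rS N : r N.+1 = r N - braket (psi N) v *: (psi N : nat -> R[i]).
  by rewrite /r big_ord_recr/= opprD addrA.
have rs N : r N \in @square_summable R.
  elim: N => [|N IH]; first by rewrite /r big_ord0 subr0.
  by rewrite rS rpredB// rpredZ.
have rpsi N k : (N <= k)%N -> braket (psi k) (r N) = braket (psi k) v.
  elim: N => [|N IH] Nk; first by rewrite /r big_ord0 subr0.
  rewrite rS addrC -scaleNr braket_linear// on gtn_eqF// mulr0 add0r.
  exact/IH/ltnW.
split; first exact: rs.
rewrite -/(r M); elim: M => [|M IH]; first by rewrite /r big_ord0 subr0 big_geq// subr0.
rewrite rS nsq_sub// rpsi// n1 mulr1 IH mul_conjc/= big_nat_recr//=; ring.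
Qed.

Lemma bessel (R : realType) (psi : nat -> ell2 R) (v : nat -> R[i]) (M : nat) :
  (forall i j, braket (psi i) (psi j) = (i == j)%:R) ->
  v \in @square_summable R ->
  \sum_(0 <= j < M) sqmod (braket (psi j) v) <= nsq _ v.
Proof.
move=> on vs; have [rs E] := orthonormal_expansion _ _ _ M on vs.
by have := nsq_ge0 _ _ rs; rewrite E subr_ge0.
Qed.

Lemma cauchy_schwarz (R : realType) (u v : nat -> R[i]) :
  u \in @square_summable R -> v \in @square_summable R ->
  sqmod (braket u v) <= nsq _ u * nsq _ v.
Proof.
move=> us vs; have u0 := nsq_ge0 _ _ us; have v0 := nsq_ge0 _ _ vs.
(* The squared norm of v - t <u|v> u for real t; its minimum is at t = 1 / [nsq _ u]. *)
have P (t : R) : 0 <= nsq _ v - 2 * (t * sqmod (braket u v))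
    + t ^+ 2 * sqmod (braket u v) * nsq _ u.
  have := nsq_ge0 _ _ (rpredB vs (rpredZ (t%:C * braket u v) us)).
  rewrite nsq_sub// rmorphM -mulrA mul_conjc sqmodM sqmod_real.
  by congr (0 <= _ - 2 * _ + _) => /=; rewrite oppr0 mul0r subr0.
have s0 := sqmod_ge0 (braket u v).
have [uz|u1] := eqVneq (nsq _ u) 0.
  rewrite uz mul0r leNgt; apply/negP => s1.
  (* When [nsq _ u = 0] the expression is affine in t, and this t makes it negative. *)
  have := P ((nsq _ v + 1) / sqmod (braket u v)).
  by rewrite uz mulr0 addr0 divfK ?gt_eqF//; lra.
have := mulr_ge0 u0 (P (nsq _ u)^-1); move=> H; rewrite -subr_ge0; move: H.
have -> : nsq _ u * (nsq _ v - 2 * ((nsq _ u)^-1 * sqmod (braket u v))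
    + (nsq _ u)^-1 ^+ 2 * sqmod (braket u v) * nsq _ u)
  = nsq _ u * nsq _ v - sqmod (braket u v) by field.
by [].
Qed.

(** * Ladder operators on sequences *)

Lemma sqnorm_annihE (R : realType) (u : nat -> R[i]) :
  sqnorm (annih u) = (\sum_(0 <= n <oo) (n%:R * sqmod (u n))%:E)%E.
Proof.
rewrite [RHS]nneseries_recl//; last by move=> k _; rewrite lee_fin mulr_ge0 ?sqmod_ge0.
rewrite mul0r add0e -(nneseries_addn 1); last first.
  by move=> k; rewrite lee_fin mulr_ge0 ?sqmod_ge0.
apply: eq_eseriesr => n _.
by rewrite /annih sqmodM sqmod_real sqr_sqrtr// addn1.
Qed.

(** The quadratic form of a a^dagger = a^dagger a + 1: [creat] weighs the n-th squared coefficient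
    by n + 1, [annih] by n. *)
Lemma sqnorm_creatE (R : realType) (u : nat -> R[i]) :
  sqnorm (creat u) = (sqnorm (annih u) + sqnorm u)%E.
Proof.
have s0 (r : R) z : 0 <= r -> (0 <= (r * sqmod z)%:E)%E.
  by move=> r0; rewrite lee_fin mulr_ge0// sqmod_ge0.
rewrite sqnorm_annihE /sqnorm -nneseriesD; last 2 first.
- by move=> n _ _; exact: s0.
- by move=> n _ _; rewrite lee_fin sqmod_ge0.
rewrite nneseries_recl//; last by move=> k _; rewrite lee_fin sqmod_ge0.
rewrite /= [X in X%:E]/sqmod/= expr0n addr0 add0e -(nneseries_addn 1); last first.
  by move=> k; rewrite lee_fin sqmod_ge0.
apply: eq_eseriesr => n _.
by rewrite addn1 /= sqmodM sqmod_real sqr_sqrtr// -EFinD -natr1 mulrDl mul1r.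
Qed.

Lemma braket_annih (R : realType) (u v : nat -> R[i]) :
  u \in @square_summable R -> v \in @square_summable R ->
  annih v \in @square_summable R -> creat u \in @square_summable R ->
  braket u (annih v) = braket (creat u) v.
Proof.
move=> us vs avs cus; apply: (ccvg_unique _ _ _ _ (braket_cvg _ _ _ us avs)).
have [cr ci] := braket_cvg _ _ _ cus vs.
(* The N-th partial sum on one side is the one of index [N.+1] on the other, because
   [creat u 0 = 0]. *)
have -> : (fun N => \sum_(0 <= n < N) (u n)^* * annih v n)
    = (fun N => \sum_(0 <= n < N.+1) (creat u n)^* * v n).
  apply/funext => N; rewrite big_nat_recl//= conjC0 mul0r add0r.
  apply: eq_bigr => n _; rewrite /annih rmorphM/= mulrCA mulrA; congr (_ * _ * _).
  by apply/eqP; rewrite eq_complex/= oppr0 !eqxx.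
split.
  by move: cr; rewrite -(cvg_shiftS (fun N =>
    complex.Re (\sum_(0 <= n < N) (creat u n)^* * v n))).
by move: ci; rewrite -(cvg_shiftS (fun N =>
    complex.Im (\sum_(0 <= n < N) (creat u n)^* * v n))).
Qed.

(** * Eigen-decompositions in Fock coefficients *)

Lemma braket_fock (R : realType) (m : nat) (v : nat -> R[i]) :
  v \in @square_summable R -> braket (fock R m) v = v m.
Proof.
move=> vs; have fs : (fock R m : nat -> R[i]) \in @square_summable R by exact: coefP.
apply: (ccvg_unique _ _ _ _ (braket_cvg _ _ _ fs vs)).
have E N : (m < N)%N -> \sum_(0 <= n < N) (fock R m n)^* * v n = v m.
  move=> mN; rewrite (bigD1_seq m)/= ?mem_index_iota ?iota_uniq//.
  rewrite /fock_seq eqxx conjC1 mul1r big1 ?addr0// => n /negbTE nm.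
  by rewrite nm conjC0 mul0r.
split; apply: cvg_near_cst; near=> N; rewrite E//; near: N; exact: nbhs_infty_gt.
Unshelve. all: by end_near. Qed.

Lemma coef_sum (R : realType) (N : nat) (f : 'I_N -> ell2 R) (n : nat) :
  (\sum_(j < N) f j : ell2 R) n = \sum_(j < N) f j n.
Proof.
elim: N f => [|N IH] f; first by rewrite !big_ord0.
by rewrite !big_ord_recr/= -(IH (fun i => f (widen_ord (leqnSn N) i))).
Qed.

Lemma ccvg_sqmod (R : realType) (s : nat -> R[i]) (l : R[i]) (b : nat -> R) :
  (forall N, sqmod (l - s N) <= b N) -> b @ \oo --> (0 : R) -> ccvg _ s l.
Proof.
move=> sb b0.
have sq0 (h : nat -> R) : (forall N, h N ^+ 2 <= b N) -> h N @[N --> \oo] --> (0 : R).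
  move=> hle; apply: (@norm_cvg0 _ _ _ \oo _ h).
  have c2 : h N ^+ 2 @[N --> \oo] --> (0 : R).
    apply: (@squeeze_cvgr _ \oo _ _ (fun=> 0) _ _ _ 0 (cvg_cst _) b0).
    by near=> N; rewrite sqr_ge0 hle.
  have -> : (fun N => `|h N|) = (fun N => Num.sqrt (h N ^+ 2)).
    by apply/funext => N; rewrite sqrtr_sqr.
  rewrite -sqrtr0; apply: continuous_cvg c2; exact: sqrt_continuous.
have BE (x y : R[i]) : (complex.Re (x - y) = complex.Re x - complex.Re y)
    * (complex.Im (x - y) = complex.Im x - complex.Im y).
  by case: x y => [? ?] [].
split.
- have /sq0 c0 : forall N, (complex.Re (l - s N)) ^+ 2 <= b N.
    by move=> N; apply: le_trans (sb N); rewrite /sqmod lerDl sqr_ge0.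
  rewrite -[X in _ --> X]subr0.
  have -> : (fun N => complex.Re (s N)) = (fun N => complex.Re l - complex.Re (l - s N)).
    by apply/funext => N; rewrite BE subKr.
  by apply: cvgB c0; exact: cvg_cst.
- have /sq0 c0 : forall N, (complex.Im (l - s N)) ^+ 2 <= b N.
    by move=> N; apply: le_trans (sb N); rewrite /sqmod lerDr sqr_ge0.
  rewrite -[X in _ --> X]subr0.
  have -> : (fun N => complex.Im (s N)) = (fun N => complex.Im l - complex.Im (l - s N)).
    by apply/funext => N; rewrite BE subKr.
  by apply: cvgB c0; exact: cvg_cst.
Unshelve. all: by end_near. Qed.

(** A single squared coefficient is at most the squared norm of the remainder. Coefficientwise
    convergence is the only form in which the strong convergence of a given decomposition is used
    afterwards. *)
Lemma eigen_coef (R : realType) (rho : ell2 R -> ell2 R) (lam : nat -> R)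
    (psi : nat -> ell2 R) (u : ell2 R) (n : nat) :
  eigen_decomposition rho lam psi ->
  ccvg _ (fun N => \sum_(j < N) (lam j)%:C * braket (psi j) u * psi j n) (rho u n).
Proof.
move=> [lam0 on /(_ u) cv].
pose r N : ell2 R := rho u - \sum_(j < N) ((lam j)%:C * braket (psi j) u) *: psi j.
have rE N : r N n = rho u n - \sum_(j < N) (lam j)%:C * braket (psi j) u * psi j n.
  by rewrite -[LHS]/(rho u n - (\sum_(j < N) ((lam j)%:C * braket (psi j) u) *: psi j : ell2 R) n) coef_sum.
have rs N : (r N : nat -> R[i]) \in @square_summable R by exact: coefP.
have cr : nsq _ (r N) @[N --> \oo] --> (0 : R).
  have : (nsq _ (r N))%:E @[N --> \oo] --> (0 : R)%:E.
    by under eq_fun do rewrite -(sqnormE _ _ (rs _)).1.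
  exact: fine_cvg.
have bnd N : sqmod (r N n) <= nsq _ (r N).
  rewrite -lee_fin -(sqnormE _ _ (rs N)).1 /sqnorm.
  have s0 k : (0 <= (sqmod (r N k))%:E)%E by rewrite lee_fin sqmod_ge0.
  rewrite (nneseriesD1 (n := n))//.
  by rewrite leeDl// nneseries_ge0// => *; exact: s0.
apply: ccvg_sqmod cr => N; rewrite -rE; exact: bnd.
Qed.

Lemma braket_fockr (R : realType) (m : nat) (v : nat -> R[i]) :
  v \in @square_summable R -> braket v (fock R m) = (v m)^*.
Proof. by move=> vs; rewrite (braketC _ (fock R m))// ?coefP// braket_fock. Qed.

Lemma orthonormal_nsq (R : realType) (psi : nat -> ell2 R) (j : nat) :
  (forall i j, braket (psi i) (psi j) = (i == j)%:R) -> nsq _ (psi j) = 1.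
Proof.
by move=> on; have := braket_self _ _ (coefP (psi j)); rewrite on eqxx => -[].
Qed.

(** The trace and the sum of the eigenvalues are the two iterated sums of the nonnegative terms
    lam_j |psi_j(n)|^2. *)
Lemma eigenvalues_sum (R : realType) (rho : ell2 R -> ell2 R) (lam : nat -> R)
    (psi : nat -> ell2 R) :
  state rho -> eigen_decomposition rho lam psi -> series lam @ \oo --> (1 : R).
Proof.
move=> [_ _ tr1] ed; have [lam0 on _] := ed.
apply: nneseries_fin_cvg => //; rewrite -tr1 /trace.
transitivity (\sum_(0 <= j <oo) \sum_(0 <= n <oo) (lam j * sqmod (psi j n))%:E)%E.
  apply: eq_eseriesr => j _.
  under eq_eseriesr do rewrite EFinM.
  rewrite nneseriesZl//; last by move=> *; rewrite lee_fin sqmod_ge0.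
  by rewrite -/(sqnorm (psi j)) (sqnormE _ _ (coefP _)).1 orthonormal_nsq// mule1.
rewrite nneseries_interchange; last by move=> *; rewrite lee_fin mulr_ge0 ?sqmod_ge0.
apply: eq_eseriesr => n _; apply: eseries_EFin.
rewrite braket_fock ?coefP//; have [cr _] := eigen_coef _ _ _ _ (fock R n) n ed.
have -> : series (fun j => lam j * sqmod (psi j n)) = (fun N =>
    complex.Re (\sum_(j < N) (lam j)%:C * braket (psi j) (fock R n) * psi j n)).
  apply/funext => N; rewrite /series/= big_mkord.
  transitivity (complex.Re (\sum_(j < N) ((lam j * sqmod (psi j n))%:C))).
    by rewrite -rmorph_sum.
  congr (complex.Re _); apply: eq_bigr => j _.
  by rewrite braket_fockr ?coefP// -mulrA mul_conjc rmorphM.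
exact: cr.
Qed.

(** * Jump sums of a state *)

(* Eigenvectors for the eigenvalue 0 need not lie in the domain of [annih], where
   [nsq] and [braket] are junk; they are masked here and in [transition]. *)
Definition ladder_sq (R : realType) (lam : nat -> R) (psi : nat -> ell2 R) (j : nat) : R :=
  if 0 < lam j then nsq _ (annih (psi j)) else 0.

Definition transition (R : realType) (lam : nat -> R) (psi : nat -> ell2 R)
    (i j : nat) : R :=
  if (0 < lam i) && (0 < lam j) then sqmod (braket (psi i) (annih (psi j))) else 0.

Lemma transition_ge0 (R : realType) (lam : nat -> R) (psi : nat -> ell2 R) (i j : nat) :
  0 <= transition _ lam psi i j.
Proof. by rewrite /transition; case: ifP => // _; exact: sqmod_ge0. Qed.

Lemma ladder_sq_ge0 (R : realType) (lam : nat -> R) (psi : nat -> ell2 R) (j : nat) :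
  (forall j, 0 < lam j -> dom_annih (psi j)) -> 0 <= ladder_sq _ lam psi j.
Proof. by move=> dom; rewrite /ladder_sq; case: ifP => // /dom; exact: nsq_ge0. Qed.

Lemma creat_nsq (R : realType) (u : ell2 R) : dom_annih u ->
  creat u \in @square_summable R /\ nsq _ (creat u) = nsq _ (annih u) + nsq _ u.
Proof.
move=> du; have us := coefP u.
have E : sqnorm (creat u) = (nsq _ (annih u) + nsq _ u)%:E.
  by rewrite sqnorm_creatE (sqnormE _ _ du).1 (sqnormE _ _ us).1 -EFinD.
have cs : creat u \in @square_summable R.
  by rewrite unfold_in /square_summable E ltry.
by split => //; have := (sqnormE _ _ cs).1; rewrite E => -[].
Qed.

Lemma transition_col (R : realType) (lam : nat -> R) (psi : nat -> ell2 R) (M j : nat) :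
  (forall i j, braket (psi i) (psi j) = (i == j)%:R) ->
  (forall j, 0 < lam j -> dom_annih (psi j)) ->
  \sum_(0 <= i < M) transition _ lam psi i j <= ladder_sq _ lam psi j.
Proof.
move=> on dom; rewrite /ladder_sq; case: ifP => lj; last first.
  by rewrite big1// => i _; rewrite /transition lj andbF.
apply: le_trans (bessel _ _ _ M on (dom _ lj)); apply: ler_sum => i _.
by rewrite /transition; case: ifP => // _; exact: sqmod_ge0.
Qed.

(** Moving the ladder operator to the other side makes the row a Bessel sum for [creat (psi i)],
    whose squared norm exceeds that of [annih (psi i)] by 1. *)
Lemma transition_row (R : realType) (lam : nat -> R) (psi : nat -> ell2 R) (M i : nat) :
  (forall i j, braket (psi i) (psi j) = (i == j)%:R) ->
  (forall j, 0 < lam j -> dom_annih (psi j)) ->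
  \sum_(0 <= j < M) transition _ lam psi i j <= ladder_sq _ lam psi i + 1.
Proof.
move=> on dom; rewrite /ladder_sq; case: ifP => li; last first.
  by rewrite big1 ?add0r// => j _; rewrite /transition li.
have [cs cE] := creat_nsq _ _ (dom _ li).
rewrite -(orthonormal_nsq _ _ i on) -cE.
apply: le_trans (bessel _ _ _ M on cs); apply: ler_sum => j _.
rewrite /transition; case: ifP => [/andP[_ lj]|_]; last exact: sqmod_ge0.
rewrite braket_annih ?coefP//; last exact: dom.
by rewrite (braketC _ (psi j)) ?coefP// sqmod_conj.
Qed.

Lemma mean_numE (R : realType) (lam : nat -> R) (psi : nat -> ell2 R) :
  (forall j, 0 <= lam j) -> finite_mean_photon lam psi ->
  exists2 N : R, mean_num lam psi = N%:E
    & series (fun j => lam j * ladder_sq _ lam psi j) @ \oo --> N.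
Proof.
move=> lam0 [dom fin].
have E : mean_num lam psi = (\sum_(0 <= j <oo) (lam j * ladder_sq _ lam psi j)%:E)%E.
  apply: eq_eseriesr => j _; rewrite /ladder_sq.
  (* For [lam j = 0] the squared norm may be infinite; the convention 0 * oo = 0 removes the
     term. *)
  have := lam0 j; rewrite le_eqVlt => /orP[/eqP<-|lj]; first by rewrite mul0e ltxx mul0r.
  by rewrite lj (sqnormE _ _ (dom _ lj)).1 EFinM.
have t0 j : 0 <= lam j * ladder_sq _ lam psi j by rewrite mulr_ge0// ladder_sq_ge0.
have /fineK F : mean_num lam psi \is a fin_num.
  by rewrite ge0_fin_numE// E; apply: nneseries_ge0 => j _ _; rewrite lee_fin.
exists (fine (mean_num lam psi)); first by rewrite F.
by apply: nneseries_fin_cvg => //; rewrite F E.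
Qed.

Lemma mean_antinumE (R : realType) (lam : nat -> R) (psi : nat -> ell2 R) (N : R) :
  (forall j, 0 <= lam j) -> finite_mean_photon lam psi ->
  (forall i j, braket (psi i) (psi j) = (i == j)%:R) ->
  series lam @ \oo --> (1 : R) ->
  mean_num lam psi = N%:E -> mean_antinum lam psi = (N + 1)%:E.
Proof.
move=> lam0 fmp on lam1 E; have [N' E' cN'] := mean_numE _ _ _ lam0 fmp.
have -> : N = N' by have := E; rewrite E' => -[].
have [dom _] := fmp.
have -> : mean_antinum lam psi
    = (\sum_(0 <= j <oo) (lam j * ladder_sq _ lam psi j + lam j)%:E)%E.
  apply: eq_eseriesr => j _; rewrite /ladder_sq.
  have := lam0 j; rewrite le_eqVlt => /orP[/eqP<-|lj]; first by rewrite mul0e ltxx mul0r addr0.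
  have [cs cE] := creat_nsq _ _ (dom _ lj).
  by rewrite lj (sqnormE _ _ cs).1 cE orthonormal_nsq// -EFinM mulrDr mulr1.
apply: eseries_EFin.
have -> : series (fun j => lam j * ladder_sq _ lam psi j + lam j)
    = series (fun j => lam j * ladder_sq _ lam psi j) \+ series lam.
  by apply/funext => n; rewrite /series/= big_split.
exact: cvgD.
Qed.

Lemma hoelder_conjV (R : realType) (p : R) : 1 < p -> (hoelder_conj p)^-1 = 1 - p^-1.
Proof. by move=> p1; rewrite /hoelder_conj; field; lra. Qed.

Lemma jump_annihE (R : realType) (p : R) (lam : nat -> R) (psi : nat -> ell2 R) :
  1 < p -> (forall j, 0 <= lam j) ->
  jump_annih p lam psi = (\sum_(0 <= i <oo) \sum_(0 <= j <oo)
    (lam i `^ (1 - p^-1) * lam j `^ p^-1 * transition _ lam psi i j)%:E)%E.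
Proof.
move=> p1 lam0; apply: eq_eseriesr => i _; apply: eq_eseriesr => j _; congr EFin.
rewrite hoelder_conjV// /transition.
have ip1 : p^-1 < 1 by rewrite invf_lt1; lra.
have ip0 : p^-1 != 0 by rewrite invr_eq0; lra.
have := lam0 i; rewrite le_eqVlt => /orP[/eqP<-|->].
  by rewrite powR0 ?subr_eq0 ?gt_eqF// !mul0r.
have := lam0 j; rewrite le_eqVlt => /orP[/eqP<-|->//].
by rewrite powR0// !mulr0 !mul0r.
Qed.

Lemma jump_creatE (R : realType) (p : R) (lam : nat -> R) (psi : nat -> ell2 R) :
  1 < p -> (forall j, 0 <= lam j) ->
  jump_creat p lam psi = (\sum_(0 <= i <oo) \sum_(0 <= j <oo)
    (lam i `^ (1 - p^-1) * lam j `^ p^-1 * transition _ lam psi j i)%:E)%E.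
Proof.
move=> p1 lam0; apply: eq_eseriesr => i _; apply: eq_eseriesr => j _; congr EFin.
rewrite hoelder_conjV// /transition andbC.
have ip1 : p^-1 < 1 by rewrite invf_lt1; lra.
have ip0 : p^-1 != 0 by rewrite invr_eq0; lra.
have := lam0 i; rewrite le_eqVlt => /orP[/eqP<-|->].
  by rewrite powR0 ?subr_eq0 ?gt_eqF// !mul0r.
have := lam0 j; rewrite le_eqVlt => /orP[/eqP<-|->//].
by rewrite powR0// !mulr0 !mul0r.
Qed.

(** A K by L rectangle of nonnegative terms is contained in the square of side M for every M >= K,
    L, so bounds on square partial sums carry over to the iterated series. *)
Lemma double_series_le (R : realType) (a : nat -> nat -> R) (B : nat -> R) (b : R) :
  (forall i j, 0 <= a i j) ->
  (forall M, \sum_(0 <= i < M) \sum_(0 <= j < M) a i j <= B M) -> B @ \oo --> b ->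
  (\sum_(0 <= i <oo) \sum_(0 <= j <oo) (a i j)%:E <= b%:E)%E.
Proof.
move=> a0 aB Bb.
have row0 i : (0 <= \sum_(0 <= j <oo) (a i j)%:E)%E.
  by apply: nneseries_ge0 => j _ _; rewrite lee_fin.
apply: lime_le; first by apply: is_cvg_nneseries.
apply: nearW => K.
rewrite -nneseries_sum_nat; last by move=> *; rewrite lee_fin.
apply: lime_le.
  by apply: is_cvg_nneseries => j _ _; apply: sume_ge0 => i _; rewrite lee_fin.
apply: nearW => L.
under eq_bigr do rewrite sumEFin.
rewrite sumEFin lee_fin -(cvg_lim _ Bb)//; apply: limr_ge.
  by apply/cvg_ex; exists b.
near=> M; apply: le_trans (aB M).
have KM : (K <= M)%N by near: M; exact: nbhs_infty_ge.
have LM : (L <= M)%N by near: M; exact: nbhs_infty_ge.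
rewrite exchange_big/= (@big_cat_nat _ _ _ _ _ _ _ _ (leq0n K) KM)/=.
rewrite -[leLHS]addr0; apply: lerD.
  apply: ler_sum => i _; rewrite (@big_cat_nat _ _ _ _ _ _ _ _ (leq0n L) LM)/=.
  by rewrite lerDl sumr_ge0.
by apply: sumr_ge0 => i _; exact: sumr_ge0.
Unshelve. all: by end_near. Qed.

Lemma double_series_ge (R : realType) (a : nat -> nat -> R) (M : nat) :
  (forall i j, 0 <= a i j) ->
  ((\sum_(0 <= i < M) \sum_(0 <= j < M) a i j)%:E
   <= \sum_(0 <= i <oo) \sum_(0 <= j <oo) (a i j)%:E)%E.
Proof.
move=> a0; have row0 i : (0 <= \sum_(0 <= j <oo) (a i j)%:E)%E.
  by apply: nneseries_ge0 => j _ _; rewrite lee_fin.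
apply: (@le_trans _ _ (\sum_(0 <= i < M) \sum_(0 <= j <oo) (a i j)%:E)%E); last first.
  by apply: nneseries_lim_ge => *; exact: row0.
rewrite -sumEFin; apply: lee_sum => i _; rewrite -sumEFin.
by apply: nneseries_lim_ge => *; rewrite lee_fin.
Qed.

(** Both jump sums, with the weights they carry in the Dirichlet form, are merged into one
    nonnegative double series; one bound on it gives the finiteness of both. *)
Definition jump_density (R : realType) (beta th : R) (lam : nat -> R)
    (psi : nat -> ell2 R) (i j : nat) : R :=
  skew _ beta th * (lam i `^ (1 - th) * lam j `^ th * transition _ lam psi i j)
  + (skew _ beta th)^-1 * (lam i `^ (1 - th) * lam j `^ th * transition _ lam psi j i).

Lemma jump_density_ge0 (R : realType) (beta th : R) (lam : nat -> R)
    (psi : nat -> ell2 R) (i j : nat) : 0 <= jump_density _ beta th lam psi i j.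
Proof.
by apply: addr_ge0; rewrite !mulr_ge0 ?invr_ge0 ?powR_ge0 ?transition_ge0// ltW// skew_gt0.
Qed.

(** Transposing the second finite sum gives both the common factor [transition _ lam psi i j], the
    shape suited to [jump_bound] and [skew_convex]. *)
Lemma jump_density_sum (R : realType) (beta th : R) (lam : nat -> R)
    (psi : nat -> ell2 R) (M : nat) :
  \sum_(0 <= i < M) \sum_(0 <= j < M) jump_density _ beta th lam psi i j =
  \sum_(0 <= i < M) \sum_(0 <= j < M)
     (skew _ beta th * (lam i `^ (1 - th) * lam j `^ th)
      + (skew _ beta th)^-1 * (lam i `^ th * lam j `^ (1 - th)))
     * transition _ lam psi i j.
Proof.
under eq_bigr do rewrite big_split/=.
under [RHS]eq_bigr do under eq_bigr do rewrite mulrDl.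
under [RHS]eq_bigr do rewrite big_split/=.
rewrite !big_split/=; congr (_ + _).
  by apply: eq_bigr => i _; apply: eq_bigr => j _; rewrite mulrA.
rewrite exchange_big/=; apply: eq_bigr => i _; apply: eq_bigr => j _.
by rewrite mulrA [lam j `^ _ * _]mulrC.
Qed.

Lemma jumpsE (R : realType) (beta p : R) (lam : nat -> R) (psi : nat -> ell2 R) :
  1 < p -> (forall j, 0 <= lam j) ->
  ((skew _ beta p^-1)%:E * jump_annih p lam psi
   + ((skew _ beta p^-1)^-1)%:E * jump_creat p lam psi
  = \sum_(0 <= i <oo) \sum_(0 <= j <oo) (jump_density _ beta p^-1 lam psi i j)%:E)%E.
Proof.
move=> p1 lam0; set k := skew _ _ _.
have k0 : 0 < k by exact: skew_gt0.
have ki0 : 0 < k^-1 by rewrite invr_gt0.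
rewrite jump_annihE// jump_creatE//.
set f := fun i => lam i `^ (1 - p^-1); set g := fun i => lam i `^ p^-1.
set m := transition _ lam psi.
have e0 i j : 0 <= f i * g j * m i j by rewrite !mulr_ge0 ?powR_ge0// transition_ge0.
have e0' i j : 0 <= f i * g j * m j i by rewrite !mulr_ge0 ?powR_ge0// transition_ge0.
have r0 i : (0 <= \sum_(0 <= j <oo) (f i * g j * m i j)%:E)%E.
  by apply: nneseries_ge0 => j _ _; rewrite lee_fin.
have r0' i : (0 <= \sum_(0 <= j <oo) (f i * g j * m j i)%:E)%E.
  by apply: nneseries_ge0 => j _ _; rewrite lee_fin.
have Zl (c : R) (h : nat -> \bar R) : (forall i, (0 <= h i)%E) ->
    (c%:E * (\sum_(0 <= i <oo) h i) = \sum_(0 <= i <oo) c%:E * h i)%E.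
  by move=> h0; rewrite nneseriesZl; [|move=> i _; exact: h0].
rewrite (Zl k _ r0) (Zl k^-1 _ r0') -nneseriesD; last 2 first.
- by move=> i _ _; apply: mule_ge0; [rewrite lee_fin ltW|exact: r0].
- by move=> i _ _; apply: mule_ge0; [rewrite lee_fin ltW|exact: r0'].
apply: eq_eseriesr => i _.
rewrite Zl; last by move=> j; rewrite lee_fin.
rewrite Zl; last by move=> j; rewrite lee_fin.
rewrite -nneseriesD//; last 2 first.
- by move=> j _ _; rewrite -EFinM lee_fin; apply: mulr_ge0; [exact: ltW|exact: e0].
- by move=> j _ _; rewrite -EFinM lee_fin; apply: mulr_ge0; [exact: ltW|exact: e0'].
Qed.

(** The limit of [jump_bound] as M grows: the partial sums T of the eigenvalues tend to 1, and T ln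
    T tends to 0 by continuity of x ln x. *)
Lemma jumps_le (R : realType) (beta p : R) (lam : nat -> R) (psi : nat -> ell2 R)
    (N S : R) :
  0 < beta -> 1 < p -> (forall j, 0 <= lam j) ->
  (forall i j, braket (psi i) (psi j) = (i == j)%:R) ->
  (forall j, 0 < lam j -> dom_annih (psi j)) ->
  series lam @ \oo --> (1 : R) ->
  series (fun j => lam j * ladder_sq _ lam psi j) @ \oo --> N ->
  series (fun j => lam j * ln (lam j)) @ \oo --> S ->
  (\sum_(0 <= i <oo) \sum_(0 <= j <oo) (jump_density _ beta p^-1 lam psi i j)%:E
  <= ((skew _ beta p^-1 + (skew _ beta p^-1)^-1) * N
      - lsi_rate _ beta p^-1 * (S - ln (1 - expR (- beta)))
      + expR (- (beta / 2)))%:E)%E.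
Proof.
move=> b0 p1 lam0 on dom lam1 cN cS; set k := skew _ _ _.
have th01 : 0 < p^-1 < 1 by rewrite invr_gt0 invf_lt1; lra.
pose T := series lam.
apply: (@double_series_le _ _ (fun M => (k + k^-1)
    * series (fun j => lam j * ladder_sq _ lam psi j) M
  + lsi_rate _ beta p^-1 * (T M * ln (T M) - series (fun j => lam j * ln (lam j)) M)
  + (lsi_rate _ beta p^-1 * ln (1 - expR (- beta)) + expR (- (beta / 2))) * T M)).
- exact: jump_density_ge0.
- move=> M; have := @jump_bound _ beta p^-1 M lam (ladder_sq _ lam psi)
    (transition _ lam psi) b0 th01 lam0
    (transition_ge0 _ lam psi) (fun j _ => transition_col _ lam psi M j on dom)
    (fun j _ => transition_row _ lam psi M j on dom) _ erefl.
  rewrite /T /series/= -/k; apply: le_trans; rewrite jump_density_sum -/k.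
  rewrite !mulr_sumr -big_split/= ler_sum// => i _.
  rewrite !mulr_sumr -big_split/= ler_sum// => j _.
  by rewrite mulrDl !mulrA.
- have -> : (k + k^-1) * N - lsi_rate R beta p^-1 * (S - ln (1 - expR (- beta)))
     + expR (- (beta / 2))
    = (k + k^-1) * N + lsi_rate R beta p^-1 * (1 * ln 1 - S)
      + (lsi_rate _ beta p^-1 * ln (1 - expR (- beta)) + expR (- (beta / 2))) * 1.
    by rewrite ln1; ring.
  apply: cvgD; last by apply: cvgMr.
  apply: cvgD; first exact: cvgMr.
  apply: cvgMr; apply: cvgB => //.
  have := @continuous_xlnx R 1; move=> cx; exact: (continuous_cvg _ cx lam1).
Qed.

(** * Relative entropy *)

(** For x > 0 the expression is x (e^s - 1 - s) with s = ln y - ln x, which is nonnegative and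
    vanishes only at s = 0. *)
Lemma xlnx_gap (R : realType) (x y : R) : 0 <= x -> 0 < y ->
  0 <= x * ln x - x * ln y - x + y
  /\ (x * ln x - x * ln y - x + y = 0 -> x = y).
Proof.
move=> x0 y0; have := x0; rewrite le_eqVlt => /orP[/eqP<-|xp].
  by rewrite !mul0r !subr0 add0r; split; [exact: ltW|move=> ->].
have E : x * ln x - x * ln y - x + y = x * (expR (ln y - ln x) - 1 - (ln y - ln x)).
  by rewrite expRD expRN !lnK ?posrE//; field; rewrite gt_eqF.
rewrite E; split.
  by rewrite mulr_ge0//; have := expR_ge1Dx (ln y - ln x); lra.
move=> /eqP; rewrite mulf_eq0 (gt_eqF xp)/= => /eqP e.
have [|n] := eqVneq (ln y - ln x) 0.
  by move=> /eqP; rewrite subr_eq0 => /eqP/ln_inj->//; rewrite posrE.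
by have := expR_gt1Dx n; lra.
Qed.

(* [p j n] stands for |psi_j(n)|^2, a doubly substochastic matrix. *)
Lemma klein (R : realType) (lam w ent : nat -> R) (p : nat -> nat -> R) (A : R) :
  (forall j, 0 <= lam j) -> (forall n, 0 < w n) -> (forall j n, 0 <= p j n) ->
  (forall j, series (p j) @ \oo --> (1 : R)) ->
  (forall n M, \sum_(0 <= j < M) p j n <= 1) ->
  series lam @ \oo --> (1 : R) -> series w @ \oo --> (1 : R) ->
  (forall j, 0 < lam j -> series (fun n => ln (w n) * p j n) @ \oo --> ent j) ->
  series (fun j => lam j * ent j) @ \oo --> A ->
  exists S : R, [/\ series (fun j => lam j * ln (lam j)) @ \oo --> S, A <= S &
    S = A -> (forall j n, p j n != 0 -> lam j = w n)
      /\ (forall n, \sum_(0 <= j < M) p j n @[M --> \oo] --> (1 : R))].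
Proof.
move=> lam0 w0 p0 p1 pc lam1 w1 entP cA.
have nd (h : nat -> R) l : (forall n, 0 <= h n) -> series h @ \oo --> l ->
    forall n, series h n <= l.
  move=> h0 hl n; rewrite -(cvg_lim _ hl)//; apply: nondecreasing_cvgn_le.
    by apply/nondecreasing_seqP => k; rewrite seriesEnat/= big_nat_recr//= lerDl.
  by apply/cvg_ex; exists l.
have term (h : nat -> R) l : (forall n, 0 <= h n) -> series h @ \oo --> l ->
    forall n, h n <= l.
  move=> h0 hl n; apply: le_trans (nd h l h0 hl n.+1).
  by rewrite /series/= big_nat_recr//= lerDr sumr_ge0.
have wl1 n : w n <= 1 by apply: term w1 n => k; exact: ltW.
pose q j := limn (series (fun n => w n * p j n)).
have wp0 j n : 0 <= w n * p j n by rewrite mulr_ge0// ltW.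
have qP j : series (fun n => w n * p j n) @ \oo --> q j.
  have : cvgn (series (p j)) by apply/cvg_ex; exists 1.
  by apply: series_le_cvg => // n; rewrite ler_piMl.
(* The divergence of [xlnx_gap] between [lam j] and [w n], weighted by [p j n]; [e j] is its sum
   over n. The linear terms make every single [t j n] nonnegative. *)
pose t j n := p j n * (lam j * ln (lam j) - lam j * ln (w n) - lam j + w n).
pose e j := lam j * ln (lam j) - lam j * ent j - lam j + q j.
have t0 j n : 0 <= t j n by rewrite mulr_ge0//; have [] := xlnx_gap _ _ _ (lam0 j) (w0 n).
have tP j : series (t j) @ \oo --> e j.
  have := lam0 j; rewrite le_eqVlt => /orP[/eqP l0|lj].
    have -> : e j = q j by rewrite /e -l0 !mul0r !subr0 add0r.
    have -> : t j = (fun n => w n * p j n).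
      by apply/funext => n; rewrite /t -l0 !mul0r !subr0 add0r mulrC.
    exact: qP.
  have -> : series (t j) = (fun n => (lam j * ln (lam j) - lam j) * series (p j) n
      - lam j * series (fun n => ln (w n) * p j n) n + series (fun n => w n * p j n) n).
    apply/funext => n; rewrite /series/= !mulr_sumr -sumrB -big_split/=.
    by apply: eq_bigr => k _; rewrite /t; ring.
  have -> : e j = (lam j * ln (lam j) - lam j) * 1 - lam j * ent j + q j.
    by rewrite /e; ring.
  apply: cvgD (qP j); apply: cvgB; apply: cvgMr; [exact: p1|exact: entP].
have e0 j : 0 <= e j by have := nd _ _ (t0 j) (tP j) 0%N; rewrite /series/= big_geq.
pose Q := series q.
have QP M : series (fun n => w n * \sum_(0 <= j < M) p j n) @ \oo --> Q M.
  elim: M => [|M IH].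
    have -> : series (fun n => w n * \sum_(0 <= j < 0) p j n) = fun=> 0.
      by apply/funext => n; rewrite /series/= big1// => k _; rewrite big_geq// mulr0.
    by rewrite /Q /series/= big_geq//; exact: cvg_cst.
  have -> : series (fun n => w n * \sum_(0 <= j < M.+1) p j n)
    = series (fun n => w n * \sum_(0 <= j < M) p j n) \+ series (fun n => w n * p M n).
    apply/funext => n; rewrite /series/= -big_split/=; apply: eq_bigr => k _.
    by rewrite big_nat_recr//= mulrDr.
  have -> : Q M.+1 = Q M + q M by rewrite /Q /series/= big_nat_recr.
  exact: cvgD.
have defP M : series (fun n => w n * (1 - \sum_(0 <= j < M) p j n)) @ \oo --> 1 - Q M.
  have -> : series (fun n => w n * (1 - \sum_(0 <= j < M) p j n))
    = series w \- series (fun n => w n * \sum_(0 <= j < M) p j n).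
    apply/funext => n; rewrite /series/= -sumrB; apply: eq_bigr => k _.
    by rewrite mulrBr mulr1.
  exact: cvgB.
have def0 M n : 0 <= w n * (1 - \sum_(0 <= j < M) p j n).
  by rewrite mulr_ge0 ?subr_ge0// ltW.
have Q1 M : Q M <= 1.
  by rewrite -subr_ge0; have := nd _ _ (def0 M) (defP M) 0%N; rewrite /series/= big_geq.
pose H := series (fun j => lam j * ln (lam j)).
have HE M : H M = series e M + series lam M - Q M + series (fun j => lam j * ent j) M.
  rewrite /H /Q /series/= -big_split/= -sumrB -big_split/=.
  by apply: eq_bigr => j _; rewrite /e; ring.
have laml1 j : lam j <= 1 by exact: term lam1 j.
(* The terms - lam_j ln lam_j are nonnegative since [lam j <= 1], and [HE] bounds their partial
   sums. *)
have [S HS] : exists S : R, H @ \oo --> S.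
  have hn M : 0 <= - (lam M * ln (lam M)).
    by rewrite oppr_ge0 mulr_ge0_le0// ln_le0.
  have cNH : cvgn (series (fun j => - (lam j * ln (lam j)))).
    apply: nondecreasing_is_cvgn.
      by apply/nondecreasing_seqP => k; rewrite seriesEnat/= big_nat_recr//= lerDl.
    have [B [_ BP]] : bounded_fun (series (fun j => lam j * ent j)).
      by apply: cvg_seq_bounded; apply/cvg_ex; exists A.
    exists (1 + (`|B| + 1)) => _ [M _ <-].
    have := BP (`|B| + 1); rewrite (le_lt_trans (ler_norm _)) ?ltrDl// => /(_ isT M I).
    have -> : series (fun j => - (lam j * ln (lam j))) M = - H M.
      by rewrite /H /series/= sumrN.
    rewrite HE /= ler_norml => /andP[b1 _].
    have E0 : 0 <= series e M by rewrite /series/= sumr_ge0.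
    have L0 : 0 <= series lam M by rewrite /series/= sumr_ge0.
    by have := Q1 M; lra.
  exists (- limn (series (fun j => - (lam j * ln (lam j))))).
  have -> : H = fun M => - series (fun j => - (lam j * ln (lam j))) M.
    by apply/funext => M; rewrite /H /series/= sumrN opprK.
  exact: cvgN.
exists S.
have cT : (fun M => H M - series (fun j => lam j * ent j) M - series lam M + 1) @ \oo
    --> S - A.
  have -> : S - A = S - A - 1 + 1 by lra.
  by apply: cvgD; [apply: cvgB => //; exact: cvgB|exact: cvg_cst].
(* In the limit, S - A splits into two nonnegative parts: the divergences [e j], and the mass
   [1 - Q M] of w that the first M rows of p leave uncovered. Both must vanish when S = A. *)
have TE M : H M - series (fun j => lam j * ent j) M - series lam M + 1
    = series e M + (1 - Q M) by rewrite HE; ring.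
split => //.
  rewrite -subr_ge0 -(cvg_lim _ cT)//; apply: limr_ge; first by apply/cvg_ex; exists (S - A).
  apply: nearW => M; rewrite TE addr_ge0 ?subr_ge0//.
  by rewrite /series/= sumr_ge0.
move=> SA.
have cz : (fun M => series e M + (1 - Q M)) @ \oo --> (0 : R).
  by have := cT; rewrite SA subrr; under eq_fun do rewrite TE.
have ez j : e j = 0.
  apply/eqP; rewrite eq_le e0 andbT -(cvg_lim _ cz)//; apply: limr_ge.
    by apply/cvg_ex; exists 0.
  near=> M; have jM : (j < M)%N by near: M; exact: nbhs_infty_gt.
  have : e j <= series e M.
    rewrite /series/= (bigD1_seq j)/= ?mem_index_iota ?iota_uniq//.
    by rewrite lerDl sumr_ge0.
  by have := Q1 M; lra.
split.
  move=> j n pjn; have tjn : t j n = 0.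
    by apply/eqP; rewrite eq_le t0 andbT -(ez j); exact: (term (t j) (e j) (t0 j) (tP j)).
  have [_] := xlnx_gap _ _ _ (lam0 j) (w0 n); apply.
  by move: tjn => /eqP; rewrite mulf_eq0 (negbTE pjn)/= => /eqP.
move=> n; have ser0 M : 0 <= series e M by rewrite /series/= sumr_ge0.
(* A defect of column n contributes [w n] times itself to [1 - Q M], and [w n > 0] can be divided
   out. *)
have c1 : (w n)^-1 * (series e M + (1 - Q M)) @[M --> \oo] --> (0 : R).
  by rewrite -(mulr0 (w n)^-1); exact: cvgMr.
have c2 : 1 - \sum_(0 <= j < M) p j n @[M --> \oo] --> (0 : R).
  apply: (@squeeze_cvgr _ \oo _ _ (fun=> 0) _ _ _ 0 (cvg_cst _) c1).
  near=> M; rewrite subr_ge0 pc/= mulrC ler_pdivlMr// mulrC.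
  by apply: le_trans (term _ _ (def0 M) (defP M) n) _; rewrite lerDr.
have -> : (fun M => \sum_(0 <= j < M) p j n) = (fun M => 1 - (1 - \sum_(0 <= j < M) p j n)).
  by apply/funext => M; rewrite subKr.
by rewrite -[X in _ --> X](subr0 (1 : R)); apply: cvgB c2; exact: cvg_cst.
Unshelve. all: by end_near. Qed.

Lemma thermal_weight_gt0 (R : realType) (beta : R) (n : nat) :
  0 < beta -> 0 < thermal_weight beta n.
Proof.
by move=> b0; rewrite mulr_gt0 ?expR_gt0// subr_gt0 -expR0 ltr_expR oppr_lt0.
Qed.

Lemma thermal_weightE (R : realType) (beta : R) (n : nat) :
  thermal_weight beta n = geometric (1 - expR (- beta)) (expR (- beta)) n.
Proof. by rewrite /thermal_weight /= -expRM_natr mulNr. Qed.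

Lemma thermal_weight_sum (R : realType) (beta : R) : 0 < beta ->
  series (thermal_weight beta) @ \oo --> (1 : R).
Proof.
move=> b0; rewrite (funext (thermal_weightE _ beta)).
have e1 : expR (- beta) < 1 by rewrite -expR0 ltr_expR oppr_lt0.
have := @cvg_geometric_series R (1 - expR (- beta)) (expR (- beta)).
rewrite ger0_norm ?expR_ge0// => /(_ e1); rewrite divff//.
by rewrite gt_eqF// subr_gt0.
Qed.

Lemma ln_thermal_weight (R : realType) (beta : R) (n : nat) : 0 < beta ->
  ln (thermal_weight beta n) = ln (1 - expR (- beta)) - beta * n%:R.
Proof.
move=> b0; rewrite lnM ?posrE ?expR_gt0 ?expRK//.
by rewrite subr_gt0 -expR0 ltr_expR oppr_lt0.
Qed.

Lemma nsq_fock (R : realType) (n : nat) : nsq _ (fock R n) = 1.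
Proof.
have fs := coefP (fock R n).
have := braket_self _ _ fs; rewrite braket_fock//= /fock_seq eqxx.
by move=> /(congr1 (@complex.Re R)).
Qed.

(* Parseval for |n> forces the orthonormal system to resolve the n-th coordinate. *)
Lemma parseval_coef (R : realType) (psi : nat -> ell2 R) (n : nat) (u : ell2 R) :
  (forall i j, braket (psi i) (psi j) = (i == j)%:R) ->
  \sum_(0 <= j < M) sqmod (psi j n) @[M --> \oo] --> (1 : R) ->
  ccvg _ (fun M => \sum_(j < M) braket (psi j) u * psi j n) (u n).
Proof.
move=> on p1; have us := coefP u; have fs := coefP (fock R n).
have ps j := coefP (psi j).
pose r M : nat -> R[i] :=
  (fock R n : nat -> R[i]) - \sum_(j < M) braket (psi j) (fock R n) *: (psi j : nat -> R[i]).
have rs M : r M \in @square_summable R := (orthonormal_expansion _ _ _ M on fs).1.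
have rN M : nsq _ (r M) = 1 - \sum_(0 <= j < M) sqmod (psi j n).
  rewrite (orthonormal_expansion _ _ _ M on fs).2 nsq_fock; congr (_ - _).
  by apply: eq_bigr => j _; rewrite braket_fockr// sqmod_conj.
have rE M : braket u (r M) = (u n - \sum_(j < M) braket (psi j) u * psi j n)^*.
  elim: M => [|M IH].
    by rewrite /r !big_ord0 !subr0 braket_fockr.
  have -> : r M.+1 = (- braket (psi M) (fock R n)) *: (psi M : nat -> R[i]) + r M.
    by rewrite /r big_ord_recr/= opprD scaleNr addrA addrC.
  rewrite braket_linear// IH big_ord_recr/= braket_fockr// (braketC _ (psi M))//.
  by rewrite opprD addrA !rmorphB/= rmorphM/= addrC mulNr [(psi M n)^* * _]mulrC.
apply: (@ccvg_sqmod _ _ _ (fun M => nsq _ u * (1 - \sum_(0 <= j < M) sqmod (psi j n)))).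
  by move=> M; rewrite -sqmod_conj -rE -rN; exact: cauchy_schwarz.
have c0 : 1 - \sum_(0 <= j < M) sqmod (psi j n) @[M --> \oo] --> (1 - 1 : R).
  by apply: cvgB p1; exact: cvg_cst.
by rewrite subrr in c0; rewrite -[X in _ --> X](mulr0 (nsq _ u)); exact: cvgMr.
Qed.

(** Each [psi j] that contributes to the n-th coefficient has eigenvalue [thermal_weight beta n], so
    the weight factors out and the Parseval expansion of [u n] remains. *)
Lemma eigen_thermal (R : realType) (beta : R) (rho : ell2 R -> ell2 R)
    (lam : nat -> R) (psi : nat -> ell2 R) :
  0 < beta -> eigen_decomposition rho lam psi ->
  (forall j n, sqmod (psi j n) != 0 -> lam j = thermal_weight beta n) ->
  (forall n, \sum_(0 <= j < M) sqmod (psi j n) @[M --> \oo] --> (1 : R)) ->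
  rho = thermal beta.
Proof.
move=> b0 ed lamw p1; have [_ on _] := ed.
apply/funext => u; apply: val_inj; apply/funext => n.
rewrite -[RHS]/(thermal beta u n) thermalE//.
apply: (ccvg_unique _ _ _ _ (eigen_coef _ _ _ _ u n ed)).
have := ccvgZ _ _ (thermal_weight beta n)%:C _ (parseval_coef _ _ n u on (p1 n)).
congr (ccvg _ _ _); apply/funext => N; rewrite mulr_sumr; apply: eq_bigr => j _.
have [z|/lamw ->] := eqVneq (sqmod (psi j n)) 0; last by rewrite mulrA.
suff -> : psi j n = 0 by rewrite !mulr0.
move: z; case: (psi j n) => a b; rewrite /sqmod/= => /eqP.
by rewrite paddr_eq0 ?sqr_ge0// !sqrf_eq0 => /andP[/eqP-> /eqP->].
Qed.

(** Strict positivity comes from the equality case of [klein]: if the relative entropy vanished,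
    [eigen_thermal] would identify rho with the thermal state. *)
Lemma rel_entropyP (R : realType) (beta : R) (rho : ell2 R -> ell2 R)
    (lam : nat -> R) (psi : nat -> ell2 R) (N : R) :
  0 < beta -> state rho -> rho <> thermal beta -> eigen_decomposition rho lam psi ->
  finite_mean_photon lam psi ->
  series (fun j => lam j * ladder_sq _ lam psi j) @ \oo --> N ->
  exists S : R, [/\ series (fun j => lam j * ln (lam j)) @ \oo --> S,
    0 < S - ln (1 - expR (- beta)) + beta * N &
    rel_entropy beta lam psi = (S - ln (1 - expR (- beta)) + beta * N)%:E].
Proof.
move=> b0 st neq ed fmp cN; have [lam0 on _] := ed; have [dom _] := fmp.
have lam1 := eigenvalues_sum _ _ _ _ st ed.
(* For [lam j > 0], [ent j] is the expectation of log sigma in [psi j], since log sigma is affine in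
   the photon number. *)
set l := ln _; pose ent j := l - beta * ladder_sq _ lam psi j.
have ps j := coefP (psi j).
have p1 j : series (fun n => sqmod (psi j n)) @ \oo --> (1 : R).
  by rewrite -(orthonormal_nsq _ _ j on); exact: (sqnormE _ _ (ps j)).2.
have entP j : 0 < lam j ->
    series (fun n => ln (thermal_weight beta n) * sqmod (psi j n)) @ \oo --> ent j.
  move=> lj; have := sqnorm_annihE _ (psi j).
  rewrite (sqnormE _ _ (dom _ lj)).1 => /esym/nneseries_fin_cvg c.
  have {}c := c (fun n => mulr_ge0 (ler0n _ _) (sqmod_ge0 _)).
  have -> : series (fun n => ln (thermal_weight beta n) * sqmod (psi j n))
    = (fun M => l * series (fun n => sqmod (psi j n)) M
       - beta * series (fun n => n%:R * sqmod (psi j n)) M).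
    apply/funext => M; rewrite /series/= !mulr_sumr -sumrB; apply: eq_bigr => n _.
    by rewrite ln_thermal_weight// mulrBl mulrA.
  rewrite /ent /ladder_sq lj -[X in X - _]mulr1.
  by apply: cvgB; apply: cvgMr.
have cA : series (fun j => lam j * ent j) @ \oo --> l - beta * N.
  have -> : series (fun j => lam j * ent j)
    = (fun M => l * series lam M - beta * series (fun j => lam j * ladder_sq _ lam psi j) M).
    apply/funext => M; rewrite /series/= !mulr_sumr -sumrB; apply: eq_bigr => j _.
    by rewrite /ent; ring.
  by rewrite -[X in X - _]mulr1; apply: cvgB; apply: cvgMr.
have pc n M : \sum_(0 <= j < M) sqmod (psi j n) <= 1.
  rewrite -(nsq_fock _ n); apply: le_trans (bessel _ _ _ M on (coefP (fock R n))).
  by apply: ler_sum => j _; rewrite braket_fockr// sqmod_conj.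
have [S [cS AS eqS]] := @klein R lam (thermal_weight beta) ent
  (fun j n => sqmod (psi j n)) _ lam0 (fun n => thermal_weight_gt0 _ _ n b0)
  (fun j n => sqmod_ge0 _) p1 pc lam1 (thermal_weight_sum _ _ b0) entP cA.
exists S; split => //.
- rewrite lt0r; apply/andP; split; last by lra.
  apply/eqP => D0; apply: neq; have [|lamw pp] := eqS; first by lra.
  exact: (eigen_thermal _ _ _ _ _ b0 ed lamw pp).
- rewrite /rel_entropy (eseries_EFin _ _ _ cS).
  have -> : (\sum_(0 <= j <oo) (lam j)%:E *
      \sum_(0 <= n <oo) (ln (thermal_weight beta n) * sqmod (psi j n))%:E
    = \sum_(0 <= j <oo) (lam j * ent j)%:E)%E.
    apply: eq_eseriesr => j _.
    have := lam0 j; rewrite le_eqVlt => /orP[/eqP<-|lj]; first by rewrite mul0e mul0r.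
    by rewrite (eseries_EFin _ _ _ (entP j lj)) EFinM.
  by rewrite (eseries_EFin _ _ _ cA) -EFinB; congr EFin; ring.
Qed.

(** * The Dirichlet form as a function of p *)

(** Convexity of x^k between s and 1, by induction: the step gains r (1 - r) (1 - s) (1 - s^k) >=
    0. *)
Lemma expr_convex1 (R : realType) (r s : R) (k : nat) : 0 <= r <= 1 -> 0 <= s <= 1 ->
  (r * s + (1 - r)) ^+ k <= r * s ^+ k + (1 - r).
Proof.
move=> /andP[r0 r1] /andP[s0 s1]; elim: k => [|k IH]; first by rewrite !expr0; lra.
have h0 : 0 <= r * s + (1 - r) by rewrite addr_ge0 ?mulr_ge0 ?subr_ge0.
rewrite [leLHS]exprS; apply: le_trans (ler_wpM2l h0 IH) _.
have sk : s ^+ k <= 1 by rewrite exprn_ile1.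
have : 0 <= r * (1 - r) * ((1 - s) * (1 - s ^+ k)) by rewrite !mulr_ge0 ?subr_ge0.
by rewrite exprS; lra.
Qed.

(* [cosh u] is a power series in [u ^ 2] with nonnegative coefficients. *)
Lemma cosh_convex (R : realType) (r v v' u : R) : 0 <= r <= 1 -> -1 <= v <= 1 ->
  v' ^+ 2 = r * v ^+ 2 + (1 - r) ->
  expR (v' * u) + expR (- (v' * u))
  <= r * (expR (v * u) + expR (- (v * u))) + (1 - r) * (expR u + expR (- u)).
Proof.
move=> r01 v1 v'E; have /andP[r0 r1] := r01.
have s01 : 0 <= v ^+ 2 <= 1 by rewrite sqr_ge0 /=; nra.
pose c x n := exp_coeff x n + exp_coeff (- x) n : R.
have cP x : series (c x) @ \oo --> expR x + expR (- x).
  have -> : series (c x) = series (exp_coeff x) \+ series (exp_coeff (- x)).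
    by apply/funext => n; rewrite /series/= big_split.
  by apply: cvgD; exact: is_cvg_series_exp_coeff.
have cE x n : c x n = (1 + (-1) ^+ n) * (x ^+ n / n`!%:R).
  by rewrite /c /exp_coeff /= (exprNn x) mulrDl mul1r mulrA.
(* The odd coefficients of [expR x + expR (- x)] cancel, and an even one of degree 2k is a k-th
   power of the squared argument, to which [expr_convex1] applies. *)
have le_c n : c (v' * u) n <= r * c (v * u) n + (1 - r) * c u n.
  rewrite !cE -signr_odd; have [on|en] := boolP (odd n).
    by rewrite expr1 subrr !mul0r !mulr0 addr0.
  have nE : n = (2 * n./2)%N by rewrite -[LHS]odd_double_half (negbTE en) add0n -muln2 mulnC.
  have pw (x : R) : x ^+ n = (x ^+ 2) ^+ n./2 by rewrite {1}nE exprM.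
  have pwM (x y : R) : (x * y) ^+ n = (x ^+ 2) ^+ n./2 * (y ^+ 2) ^+ n./2.
    by rewrite (exprMn n x y) !pw.
  have f0 : 0 <= n`!%:R^-1 :> R by rewrite invr_ge0 ler0n.
  have g0 : 0 <= (1 + (-1) ^+ false) * ((u ^+ 2) ^+ n./2 / n`!%:R).
    by rewrite expr0 mulr_ge0// mulr_ge0// exprn_ge0// sqr_ge0.
  have := ler_wpM2r g0 (expr_convex1 _ r (v ^+ 2) n./2 r01 s01).
  by rewrite (pwM v' u) (pwM v u) (pw u) v'E; congr (_ <= _); ring.
have cR : (fun n => r * series (c (v * u)) n + (1 - r) * series (c u) n) @ \oo -->
    r * (expR (v * u) + expR (- (v * u))) + (1 - r) * (expR u + expR (- u)).
  by apply: cvgD; apply: cvgMr; exact: cP.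
rewrite -(cvg_lim _ (cP (v' * u)))// -(cvg_lim _ cR)//; apply: ler_lim.
- by apply/cvg_ex; exists (expR (v' * u) + expR (- (v' * u))).
- by apply/cvg_ex; eexists; exact: cR.
- apply: nearW => n; rewrite /series/= !mulr_sumr -big_split/=.
  by apply: ler_sum => i _; exact: le_c.
Qed.

(** For positive a and b, with mu = (ln a + ln b) / 2 and u = (beta + ln b - ln a) / 2, the mixed
    terms are 2 e^mu cosh((2 th - 1) u) and the last bracket is 2 e^mu cosh u. Since (2 th - 1)^2 =
    1 - 4 th (1 - th), the ratio r interpolates linearly between the squares (2 th - 1)^2 and 1. *)
Lemma skew_convex (R : realType) (beta th th' a b : R) :
  0 < th < 1 -> 0 < th' < 1 -> 0 <= a -> 0 <= b ->
  th' * (1 - th') <= th * (1 - th) ->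
  let r := th' * (1 - th') / (th * (1 - th)) in
  skew _ beta th' * (a `^ (1 - th') * b `^ th')
    + (skew _ beta th')^-1 * (a `^ th' * b `^ (1 - th'))
  <= r * (skew _ beta th * (a `^ (1 - th) * b `^ th)
          + (skew _ beta th)^-1 * (a `^ th * b `^ (1 - th)))
     + (1 - r) * (expR (- (beta / 2)) * a + expR (beta / 2) * b).
Proof.
move=> /andP[t0 t1] /andP[t0' t1'] a0 b0 tt.
have q0 : 0 < th * (1 - th) by rewrite mulr_gt0// subr_gt0.
have q0' : 0 < th' * (1 - th') by rewrite mulr_gt0// subr_gt0.
cbv zeta; set r := _ / _; have r01 : 0 <= r <= 1.
  apply/andP; split; last by rewrite /r ler_pdivrMr// mul1r.
  by apply: divr_ge0; exact: ltW.
have rq : r * (th * (1 - th)) = th' * (1 - th') by rewrite divfK// gt_eqF.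
have /andP[r0 r1] := r01.
have [az|bz] : (a = 0 \/ b = 0) \/ (0 < a /\ 0 < b).
  move: a0 b0; rewrite !le_eqVlt => /orP[/eqP<-|->]; first by left; left.
  by move=> /orP[/eqP<-|->]; [left; right|right].
- have z (s : R) : 0 < s < 1 -> (a `^ s * b `^ (1 - s) = 0) * (a `^ (1 - s) * b `^ s = 0).
    move=> /andP[s0 s1]; case: az => ->;
      by rewrite !powR0 ?(gt_eqF s0) ?subr_eq0 ?(gt_eqF s1)// !(mul0r, mulr0).
  rewrite !z ?t0 ?t0'// !mulr0 !addr0 mulr0 add0r.
  by rewrite mulr_ge0 ?subr_ge0// addr_ge0// mulr_ge0// expR_ge0.
- move: bz => [ap bp]; pose mu := (ln a + ln b) / 2; pose u := (beta + ln b - ln a) / 2.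
  have pE (x s : R) : 0 < x -> x `^ s = expR (s * ln x) by move=> x0; rewrite /powR gt_eqF.
  have hE (s : R) : skew _ beta s * (a `^ (1 - s) * b `^ s)
      + (skew _ beta s)^-1 * (a `^ s * b `^ (1 - s))
      = expR mu * (expR ((2 * s - 1) * u) + expR (- ((2 * s - 1) * u))).
    rewrite !pE// /skew -expRN [RHS]mulrDr -!expRD.
    by congr (expR _ + expR _); rewrite /mu /u; lra.
  have xE : expR (- (beta / 2)) * a + expR (beta / 2) * b
      = expR mu * (expR u + expR (- u)).
    have aE : a = expR (ln a) by rewrite lnK ?posrE.
    have bE : b = expR (ln b) by rewrite lnK ?posrE.
    rewrite [RHS]mulrDr addrC {1}bE {1}aE -!expRD.
    by congr (expR _ + expR _); rewrite /mu /u; lra.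
  have v1 : -1 <= 2 * th - 1 <= 1 by apply/andP; split; lra.
  have vE : (2 * th' - 1) ^+ 2 = r * (2 * th - 1) ^+ 2 + (1 - r).
    have -> : (2 * th - 1) ^+ 2 = 1 - 4 * (th * (1 - th)) by ring.
    by rewrite mulrBr mulrCA rq; ring.
  have := ler_wpM2l (expR_ge0 mu) (cosh_convex _ _ _ _ u r01 v1 vE).
  rewrite (hE th') (hE th) xE; move: (expR mu) => e.
  move: (expR u + _) (expR _ + expR _) (expR _ + expR _) => x y z.
  by congr (_ <= _); ring.
Qed.

Definition lsi_value (R : realType) (beta p : R) : R :=
  p * hoelder_conj p / 4 * lsi_rate _ beta p^-1.

Lemma hoelder_prod (R : realType) (p : R) : 1 < p ->
  p * hoelder_conj p = (p^-1 * (1 - p^-1))^-1.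
Proof. by move=> p1; rewrite /hoelder_conj; field; lra. Qed.

Lemma fin_num_comb (R : realType) (a b : R) (x y : \bar R) :
  0 < a -> 0 < b -> (0 <= x)%E -> (0 <= y)%E -> (a%:E * x + b%:E * y < +oo)%E ->
  exists x' y' : R, x = x'%:E /\ y = y'%:E.
Proof.
move=> a0 b0; case: x y => [x| |] [y| |]// _ _; rewrite ?gt0_muley ?lte_fin//.
by exists x, y.
Qed.

(** Finiteness of the merged series makes each jump sum finite, so the differences in the form are
    differences of real numbers. *)
Lemma dirichlet_gt1E (R : realType) (beta p : R) (lam : nat -> R) (psi : nat -> ell2 R)
    (N : R) :
  1 < p -> (forall j, 0 <= lam j) ->
  mean_num lam psi = N%:E -> mean_antinum lam psi = (N + 1)%:E ->
  (\sum_(0 <= i <oo) \sum_(0 <= j <oo) (jump_density _ beta p^-1 lam psi i j)%:E < +oo)%E ->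
  exists2 H : R,
    (\sum_(0 <= i <oo) \sum_(0 <= j <oo) (jump_density _ beta p^-1 lam psi i j)%:E = H%:E)%E &
    dirichlet_gt1 beta p lam psi = (p * hoelder_conj p / 4
      * (expR (- (beta / 2)) * (N + 1) + expR (beta / 2) * N - H))%:E.
Proof.
move=> p1 lam0 nE aE; set J := (\sum_(_ <= _ <oo) _)%E => Joo.
have k0 := skew_gt0 _ beta p^-1; set k := skew _ _ _ in k0.
have ki0 : 0 < k^-1 by rewrite invr_gt0.
have JE : (J = k%:E * jump_annih p lam psi + k^-1%:E * jump_creat p lam psi)%E.
  by rewrite /k jumpsE.
have ja0 : (0 <= jump_annih p lam psi)%E.
  apply: nneseries_ge0 => i _ _; apply: nneseries_ge0 => j _ _.
  by rewrite lee_fin !mulr_ge0 ?powR_ge0 ?sqmod_ge0.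
have jc0 : (0 <= jump_creat p lam psi)%E.
  apply: nneseries_ge0 => i _ _; apply: nneseries_ge0 => j _ _.
  by rewrite lee_fin !mulr_ge0 ?powR_ge0 ?sqmod_ge0.
have Joo' := Joo; rewrite JE in Joo'.
have [ja [jc [aF cF]]] := fin_num_comb _ _ _ _ _ k0 ki0 ja0 jc0 Joo'.
exists (k * ja + k^-1 * jc); first by rewrite JE aF cF.
rewrite /dirichlet_gt1 nE aE aF cF; transitivity (p * hoelder_conj p / 4 *
  (expR (- (beta / 2)) * (N + 1 - expR (beta / p) * ja)
   + expR (beta / 2) * (N - expR (- (beta / p)) * jc)))%:E; first by [].
congr EFin.
have e1 : expR (- (beta / 2)) * expR (beta / p) = k.
  by rewrite /k /skew -expRD; congr expR; rewrite mulrBr; lra.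
have e2 : expR (beta / 2) * expR (- (beta / p)) = k^-1.
  by rewrite /k /skew -expRN -expRD; congr expR; rewrite mulrBr; lra.
by congr (_ * _); rewrite 2!mulrBr [_ * (_ * ja)]mulrA e1 [_ * (_ * jc)]mulrA e2; ring.
Qed.

(** The numerator of [lsi_rate] is what remains of the coefficient of N after the jump bound. The
    mean photon number thus enters exactly as beta N times the rate, as in the relative entropy, and
    the constants e^(-beta/2) cancel. *)
Lemma dirichlet_lower (R : realType) (beta p : R) (rho : ell2 R -> ell2 R)
    (lam : nat -> R) (psi : nat -> ell2 R) (D : R) :
  0 < beta -> 1 < p -> state rho -> rho <> thermal beta ->
  eigen_decomposition rho lam psi -> finite_mean_photon lam psi ->
  rel_entropy beta lam psi = D%:E ->
  exists2 E : R, dirichlet_gt1 beta p lam psi = E%:E & lsi_value _ beta p * D <= E.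
Proof.
move=> b0 p1 st neq ed fmp DE; have [lam0 on _] := ed; have [dom _] := fmp.
have lam1 := eigenvalues_sum _ _ _ _ st ed.
have [N nE cN] := mean_numE _ _ _ lam0 fmp.
have aE := mean_antinumE _ _ _ N lam0 fmp on lam1 nE.
have [S [cS D0 DE']] := rel_entropyP _ _ _ _ _ _ b0 st neq ed fmp cN.
have -> : D = S - ln (1 - expR (- beta)) + beta * N by move: DE; rewrite DE' => -[].
have JH := jumps_le _ _ _ _ _ _ _ b0 p1 lam0 on dom lam1 cN cS.
have [|H HE ->] := dirichlet_gt1E _ beta p lam psi N p1 lam0 nE aE.
  by rewrite (le_lt_trans JH)// ltry.
eexists; first reflexivity.
move: JH; rewrite HE lee_fin => JH.
have pp0 : 0 <= p * hoelder_conj p / 4.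
  by rewrite hoelder_prod// divr_ge0// invr_ge0 mulr_ge0 ?subr_ge0 ?invr_ge0 ?invf_le1; lra.
rewrite /lsi_value -mulrA; apply: ler_wpM2l => //.
set c := lsi_rate _ _ _ in JH *; set k := skew _ _ _ in JH.
have cE : c * beta = expR (beta / 2) + expR (- (beta / 2)) - k - k^-1.
  by rewrite /c /lsi_rate divfK// gt_eqF.
by rewrite mulrDr mulrA cE; lra.
Qed.

(** [skew_convex] applies entry by entry to the jump density. Its affine remainder is summed by the
    row and column bounds, which give at most the jump-free part X of the form. *)
Lemma dirichlet_gt1_nonincreasing (R : realType) (beta : R) (rho : ell2 R -> ell2 R)
    (lam : nat -> R) (psi : nat -> ell2 R) (p q : R) :
  0 < beta -> state rho -> rho <> thermal beta ->
  eigen_decomposition rho lam psi -> finite_mean_photon lam psi ->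
  1 < p -> p <= q -> q < 2 ->
  (dirichlet_gt1 beta q lam psi <= dirichlet_gt1 beta p lam psi)%E.
Proof.
move=> b0 st neq ed fmp p1 pq q2; have [lam0 on _] := ed; have [dom _] := fmp.
have q1 : 1 < q by lra.
have lam1 := eigenvalues_sum _ _ _ _ st ed.
have [N nE cN] := mean_numE _ _ _ lam0 fmp.
have aE := mean_antinumE _ _ _ N lam0 fmp on lam1 nE.
have [S [cS _ _]] := rel_entropyP _ _ _ _ _ _ b0 st neq ed fmp cN.
have Jfin (s : R) : 1 < s -> (\sum_(0 <= i <oo) \sum_(0 <= j <oo)
    (jump_density _ beta s^-1 lam psi i j)%:E < +oo)%E.
  move=> s1; apply: le_lt_trans (ltry _).
  exact: (jumps_le _ _ _ _ _ _ _ b0 s1 lam0 on dom lam1 cN cS).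
have [H HE ->] := dirichlet_gt1E _ beta p lam psi N p1 lam0 nE aE (Jfin _ p1).
have [K KE ->] := dirichlet_gt1E _ beta q lam psi N q1 lam0 nE aE (Jfin _ q1).
rewrite lee_fin !hoelder_prod//.
set X := expR (- (beta / 2)) * (N + 1) + expR (beta / 2) * N.
have ip (s : R) : 1 < s -> 0 < s^-1 < 1 by move=> s1; rewrite invr_gt0 invf_lt1; lra.
have /andP[ip0 ip1] := ip _ p1; have /andP[iq0 iq1] := ip _ q1.
have iqp : q^-1 <= p^-1 by rewrite lef_pV2// posrE; lra.
(* The bound q < 2 puts both reciprocals on the decreasing branch of x (1 - x). *)
have iq2 : 2^-1 < q^-1 by rewrite ltf_pV2// posrE; lra.
have le2 : p^-1 * (1 - p^-1) <= q^-1 * (1 - q^-1) by nra.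
have u0 : 0 < p^-1 * (1 - p^-1) by rewrite mulr_gt0// subr_gt0.
have v0 : 0 < q^-1 * (1 - q^-1) by rewrite mulr_gt0// subr_gt0.
set r := p^-1 * (1 - p^-1) / (q^-1 * (1 - q^-1)).
have r0 : 0 <= r by rewrite divr_ge0// ltW.
have r1 : r <= 1 by rewrite /r ler_pdivrMr// mul1r.
(* Up to the factor 1/4 the two forms are (X - H) and (X - K) divided by p^-1 (1 - p^-1) and q^-1 (1
   - q^-1), so the claim amounts to X - H >= r (X - K). *)
suff HK : H <= r * K + (1 - r) * X.
  have -> : (p^-1 * (1 - p^-1))^-1 = (r * (q^-1 * (1 - q^-1)))^-1.
    by rewrite divfK// gt_eqF.
  have rp : 0 < r by rewrite divr_gt0.
  have B : X - K <= r^-1 * (X - H) by rewrite mulrC ler_pdivlMr//; lra.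
  have c0 : 0 <= (q^-1 * (1 - q^-1))^-1 / 4 by rewrite divr_ge0// invr_ge0 ltW.
  apply: le_trans (ler_wpM2l c0 B) _; rewrite (invfM r) le_eqVlt; apply/orP; left.
  by apply/eqP; ring.
rewrite -lee_fin -HE.
pose L := series (fun j => lam j * ladder_sq _ lam psi j).
apply: (@double_series_le _ _ (fun M => r * K + (1 - r)
   * (expR (- (beta / 2)) * (L M + series lam M) + expR (beta / 2) * L M))).
- exact: jump_density_ge0.
- move=> M; have KM : \sum_(0 <= i < M) \sum_(0 <= j < M)
      jump_density _ beta q^-1 lam psi i j <= K.
    by rewrite -lee_fin -KE; apply: double_series_ge => i j; exact: jump_density_ge0.
  apply: le_trans (lerD (ler_wpM2l r0 KM) (lexx _)).
  rewrite !jump_density_sum; set m := transition _ lam psi.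
  apply: (@le_trans _ _ (r * (\sum_(0 <= i < M) \sum_(0 <= j < M)
     (skew _ beta q^-1 * (lam i `^ (1 - q^-1) * lam j `^ q^-1)
      + (skew _ beta q^-1)^-1 * (lam i `^ q^-1 * lam j `^ (1 - q^-1))) * m i j)
    + (1 - r) * \sum_(0 <= i < M) \sum_(0 <= j < M)
       (expR (- (beta / 2)) * lam i + expR (beta / 2) * lam j) * m i j)).
    rewrite !mulr_sumr -big_split/=; apply: ler_sum => i _.
    rewrite !mulr_sumr -big_split/=; apply: ler_sum => j _.
    rewrite !mulrA -mulrDl ler_wpM2r ?transition_ge0//.
    have := skew_convex _ beta q^-1 p^-1 (lam i) (lam j) (ip _ q1) (ip _ p1)
      (lam0 i) (lam0 j) le2.
    by rewrite -/r /= !mulrA.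
  rewrite lerD2l ler_wpM2l ?subr_ge0//.
  under eq_bigr do under eq_bigr do rewrite mulrDl.
  under eq_bigr do rewrite big_split/=.
  rewrite big_split/= [X in _ + X <= _]exchange_big/=.
  apply: lerD.
    rewrite /L /series/= -big_split/= mulr_sumr; apply: ler_sum => i _.
    rewrite -mulr_sumr -mulrA ler_wpM2l ?expR_ge0//.
    have := ler_wpM2l (lam0 i) (transition_row _ lam psi M i on dom).
    by rewrite mulrDr mulr1.
  rewrite /L /series/= mulr_sumr; apply: ler_sum => j _.
  rewrite -mulr_sumr -mulrA ler_wpM2l ?expR_ge0//.
  by apply: ler_wpM2l; [exact: lam0|exact: transition_col].
- apply: cvgD; first exact: cvg_cst.
  rewrite /X; apply: cvgMr; apply: cvgD; apply: cvgMr => //; exact: cvgD.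
Qed.

(* [gap a1 a2 th] is the classical Dirichlet form of a single transition between
   the weights [expR a1] and [expR a2]. *)
Definition gap (R : realType) (a1 a2 th : R) : R :=
  (expR (a1 * th) - expR (a2 * th)) * (expR (a1 * (1 - th)) - expR (a2 * (1 - th))).

(** At b = 0 this is the numerator of [lsi_rate]; for b > 0 it is, up to normalisation, the form of
    the thermal state of parameter b. *)
Lemma gapE (R : realType) (beta b th : R) :
  gap _ (- (beta / 2)) (beta / 2 - b) th
  = expR (- (beta / 2)) + expR (beta / 2 - b) - skew _ beta th * expR (- (b * th))
    - (skew _ beta th)^-1 * expR (b * th - b).
Proof.
have H (x y z w : R) : (x - y) * (z - w) = x * z + y * w - y * z - x * w by ring.
rewrite /gap /skew H -expRN -!expRD; congr (expR _ + expR _ - expR _ - expR _); lra.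
Qed.

Lemma lsi_rate_gap (R : realType) (beta th : R) : 0 < beta ->
  lsi_rate _ beta th = gap _ (- (beta / 2)) (beta / 2) th / beta.
Proof.
move=> b0; have := gapE _ beta 0 th; rewrite subr0 => ->.
by rewrite mul0r oppr0 addr0 expR0 !mulr1 /lsi_rate [X in X - _ - _]addrC.
Qed.

Lemma lsi_valueE (R : realType) (beta p p' : R) :
  0 < beta -> 1 < p -> p^-1 + p'^-1 = 1 ->
  lsi_value _ beta p = p * p' / (4 * beta) * expR (beta / 2)
    * (1 - expR (- (beta / p))) * (1 - expR (- (beta / p'))).
Proof.
move=> b0 p1 pp'; rewrite /lsi_value.
have -> : hoelder_conj p = p'.
  by rewrite -[LHS]invrK -[RHS]invrK hoelder_conjV//; congr _^-1; lra.
have -> : lsi_rate _ beta p^-1 = expR (beta / 2)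
    * (1 - expR (- (beta / p))) * (1 - expR (- (beta / p'))) / beta.
  rewrite /lsi_rate /skew -expRN; congr (_ / _).
  have H (x y z : R) : x * (1 - y) * (1 - z) = x + x * (y * z) - x * z - x * y by ring.
  have -> : p'^-1 = 1 - p^-1 by lra.
  by rewrite H -!expRD; congr (_ + expR _ - expR _ - expR _); lra.
rewrite [(4 * beta)^-1]invfM; ring.
Qed.

(** * Limits as p decreases to 1 *)

Lemma cvg_invr1 (R : realType) : p^-1 @[p --> (1 : R)^'+] --> (1 : R).
Proof.
rewrite -[X in _ --> X]invr1; apply: cvg_at_right_filter.
by apply: cvgV; [exact: oner_neq0|exact: cvg_id].
Qed.

Lemma expR_slope (R : realType) (a : R) :
  (expR (a * (1 - p^-1)) - 1) / (1 - p^-1) @[p --> (1 : R)^'+] --> a.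
Proof.
have h0 : a * (1 - p^-1) @[p --> (1 : R)^'+] --> (0 : R).
  rewrite -[X in _ --> X](mulr0 a) -(subrr (1 : R)); apply: cvgMr.
  by apply: cvgB; [exact: cvg_cst|exact: cvg_invr1].
have h1 : a * expR (a * (1 - p^-1)) @[p --> (1 : R)^'+] --> a.
  suff : a * expR (a * (1 - p^-1)) @[p --> (1 : R)^'+] --> a * expR 0.
    by rewrite expR0 mulr1.
  by apply: cvgMr; apply: continuous_cvg h0; exact: continuous_expR.
(* With h = 1 - p^-1 > 0, the inequality 1 + x <= e^x at x = a h and at x = - a h encloses the slope
   between a and a e^(a h). *)
apply: (@squeeze_cvgr _ _ _ _ (fun=> a) _ _ _ a (cvg_cst _) h1).
near=> p; have p1 : 1 < p by near: p; exact: nbhs_right_gt.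
have hp : 0 < 1 - p^-1 by rewrite subr_gt0 invf_lt1//; lra.
set h := 1 - p^-1 in hp *.
rewrite ler_pdivlMr// ler_pdivrMr//; apply/andP; split.
  by have := expR_ge1Dx (a * h); lra.
have e := expR_gt0 (a * h).
have := expR_ge1Dx (- (a * h)); rewrite expRN => H.
have := ler_wpM2l (ltW e) H; rewrite mulfV ?gt_eqF//; lra.
Unshelve. all: by end_near. Qed.

(** As p^-1 tends to 1, one factor of [gap] tends to [expR a1 - expR a2], while the other vanishes
    like (a1 - a2) (1 - p^-1). *)
Lemma gap_slope (R : realType) (a1 a2 : R) :
  gap _ a1 a2 p^-1 / (p^-1 * (1 - p^-1)) @[p --> (1 : R)^'+]
  --> (expR a1 - expR a2) * (a1 - a2).
Proof.
have e (a : R) : expR (a * p^-1) @[p --> (1 : R)^'+] --> expR a.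
  have c : a * p^-1 @[p --> (1 : R)^'+] --> a * 1 by apply: cvgMr; exact: cvg_invr1.
  by rewrite mulr1 in c; apply: continuous_cvg c; exact: continuous_expR.
have : (expR (a1 * p^-1) - expR (a2 * p^-1)) * p *
    ((expR (a1 * (1 - p^-1)) - 1) / (1 - p^-1) - (expR (a2 * (1 - p^-1)) - 1) / (1 - p^-1))
    @[p --> (1 : R)^'+] --> (expR a1 - expR a2) * 1 * (a1 - a2).
  apply: cvgM; last by apply: cvgB; exact: expR_slope.
  by apply: cvgM; [apply: cvgB; exact: e|apply: cvg_at_right_filter; exact: cvg_id].
rewrite mulr1; apply: cvg_trans; apply: near_eq_cvg; near=> p.
have p1 : 1 < p by near: p; exact: nbhs_right_gt.
have hp : 0 < 1 - p^-1 by rewrite subr_gt0 invf_lt1//; lra.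
rewrite /gap invfM invrK -mulrBl; set h := 1 - p^-1 in hp *; ring.
Unshelve. all: by end_near. Qed.

Lemma lsi_value_cvg (R : realType) (beta : R) : 0 < beta ->
  lsi_value _ beta p @[p --> (1 : R)^'+] --> 2^-1 * sinh (beta / 2).
Proof.
move=> b0; have : gap _ (- (beta / 2)) (beta / 2) p^-1 / (p^-1 * (1 - p^-1)) * (4 * beta)^-1
    @[p --> (1 : R)^'+] --> (expR (- (beta / 2)) - expR (beta / 2))
      * (- (beta / 2) - beta / 2) * (4 * beta)^-1.
  by apply: cvgMl; exact: gap_slope.
have -> : (expR (- (beta / 2)) - expR (beta / 2)) * (- (beta / 2) - beta / 2) * (4 * beta)^-1
    = 2^-1 * sinh (beta / 2) by rewrite /sinh; field; rewrite gt_eqF.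
apply: cvg_trans; apply: near_eq_cvg; near=> p.
have p1 : 1 < p by near: p; exact: nbhs_right_gt.
rewrite /lsi_value hoelder_prod// lsi_rate_gap// (invfM 4); ring.
Unshelve. all: by end_near. Qed.

(** * Lower bounds on the constant *)

Lemma ediv_fin (R : realType) (x y : R) : 0 < y -> (x%:E / y%:E = (x / y)%:E)%E.
Proof. by move=> y0; rewrite inver gt_eqF. Qed.

Lemma lsi_const_ge (R : realType) (beta p : R) : 0 < beta -> 1 < p ->
  ((lsi_value _ beta p)%:E <= lsi_const beta p)%E.
Proof.
move=> b0 p1; apply/ereal_infP => _ [rho [lam [psi [st neq ed fmp ->]]]].
have [lam0 _ _] := ed; have [N _ cN] := mean_numE _ _ _ lam0 fmp.
have [S [_ D0 DE]] := rel_entropyP _ _ _ _ _ _ b0 st neq ed fmp cN.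
have [E EE le] := dirichlet_lower _ _ _ _ _ _ _ b0 p1 st neq ed fmp DE.
by rewrite /dirichlet gt_eqF// EE DE ediv_fin// lee_fin ler_pdivlMr.
Qed.

Lemma lsi_const1_ge (R : realType) (beta : R) : 0 < beta ->
  ((2^-1 * sinh (beta / 2))%:E <= lsi_const beta 1)%E.
Proof.
move=> b0; apply/ereal_infP => _ [rho [lam [psi [st neq ed fmp ->]]]].
have [lam0 _ _] := ed; have [N _ cN] := mean_numE _ _ _ lam0 fmp.
have [S [_ D0 DE]] := rel_entropyP _ _ _ _ _ _ b0 st neq ed fmp cN.
rewrite /dirichlet eqxx DE; set D := (X in X%:E) in D0 DE *.
(* Without convergence [lim] would be a default value. The limit may be infinite, so monotone
   convergence is used in the extended reals. *)
have cE : cvg (dirichlet_gt1 beta q lam psi @[q --> (1 : R)^'+]).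
  apply: nonincreasing_at_right_is_cvge; near=> x => p q.
  rewrite !in_itv/= => /andP[p1 px] /andP[q1 qx] pq.
  apply: dirichlet_gt1_nonincreasing ed fmp p1 pq _ => //.
  by apply: (lt_trans qx); near: x; apply: nbhs_right_lt; lra.
have cl : (lsi_value _ beta q * D)%:E @[q --> (1 : R)^'+]
    --> (2^-1 * sinh (beta / 2) * D)%:E.
  apply: cvg_EFin; first exact: nearW.
  by apply: cvgMl; exact: lsi_value_cvg.
rewrite inver gt_eqF// lee_pdivlMr// -EFinM -(cvg_lim _ cl)//.
apply: lee_lim => //; first by apply/cvg_ex; eexists; exact: cl.
near=> q; have q1 : 1 < q by near: q; exact: nbhs_right_gt.
have [E -> le] := dirichlet_lower _ _ _ _ _ _ _ b0 q1 st neq ed fmp DE.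
by rewrite lee_fin.
Unshelve. all: by end_near. Qed.

(** * Thermal states *)

Lemma state_thermal (R : realType) (b : R) : 0 < b -> state (@thermal R b).
Proof.
move=> b0; split.
- move=> a u v; apply: val_inj; apply/funext => n.
  rewrite -[LHS]/(thermal b (a *: u + v) n) thermalE//.
  rewrite -[RHS]/(a * thermal b u n + thermal b v n) !thermalE//.
  by rewrite -[(a *: u + v) n]/(a * u n + v n) mulrDr mulrCA.
- move=> u; have [cr ci] := braket_cvg _ _ _ (coefP u) (coefP (thermal b u)).
  have E N : \sum_(0 <= n < N) (u n)^* * thermal b u n
      = (\sum_(0 <= n < N) thermal_weight b n * sqmod (u n))%:C.
    rewrite rmorph_sum/=; apply: eq_bigr => n _.
    by rewrite thermalE// mulrCA mul_conjc -rmorphM.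
  rewrite lecE; apply/andP; split.
    have ci0 : complex.Im (\sum_(0 <= n < N) (u n)^* * thermal b u n) @[N --> \oo] --> (0 : R).
      by under eq_fun do rewrite E /=; exact: cvg_cst.
    by rewrite -(cvg_lim _ ci)// (cvg_lim _ ci0).
  rewrite -(cvg_lim _ cr)//; apply: limr_ge; first by apply/cvg_ex; eexists; exact: cr.
  apply: nearW => N; rewrite E/=; apply: sumr_ge0 => n _.
  by rewrite mulr_ge0 ?sqmod_ge0// ltW// thermal_weight_gt0.
- rewrite /trace -(eseries_EFin _ _ _ (thermal_weight_sum _ _ b0)).
  apply: eq_eseriesr => n _.
  by rewrite braket_fock ?coefP// thermalE//= /fock_seq eqxx mulr1.
Qed.

Lemma thermal_neq (R : realType) (b beta : R) : 0 < b -> 0 < beta -> b != beta ->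
  @thermal R b <> thermal beta.
Proof.
move=> b0 beta0 /eqP neq e.
have H (u : ell2 R) : u 0%N = 1 -> thermal b u 0%N = thermal beta u 0%N ->
    thermal_weight b 0 = thermal_weight beta 0.
  move=> u1; rewrite (thermalE u 0 b0) (thermalE u 0 beta0) u1 !mulr1.
  by move=> /(congr1 (@complex.Re R)).
have := H (fock R 0) erefl (congr1 (fun f => coef (f (fock R 0)) 0%N) e).
rewrite /thermal_weight !mulr0 oppr0 expR0 !mulr1 => w.
have /expR_inj : expR (- b) = expR (- beta) by lra.
by move=> bb; apply: neq; lra.
Qed.

Lemma fock_orthonormal (R : realType) (i j : nat) :
  braket (fock R i) (fock R j) = (i == j)%:R.
Proof. by rewrite braket_fock ?coefP. Qed.

(** The N-th remainder is [thermal b u] with its first N coefficients removed; the weights are at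
    most 1, so the tail of [sqnorm u] dominates it. *)
Lemma eigen_thermal_fock (R : realType) (b : R) : 0 < b ->
  eigen_decomposition (@thermal R b) (thermal_weight b) (fock R).
Proof.
move=> b0; split; first by move=> j; exact/ltW/thermal_weight_gt0.
  exact: fock_orthonormal.
move=> u; have us := coefP u.
pose r N : ell2 R := thermal b u
  - \sum_(j < N) ((thermal_weight b j)%:C * braket (fock R j) u) *: fock R j.
have rE N n : r N n = if (n < N)%N then 0 else (thermal_weight b n)%:C * u n.
  rewrite -[LHS]/(thermal b u n - (\sum_(j < N)
    ((thermal_weight b j)%:C * braket (fock R j) u) *: fock R j : ell2 R) n).
  rewrite coef_sum thermalE//.
  have -> : \sum_(j < N) (((thermal_weight b j)%:C * braket (fock R j) u) *: fock R j : ell2 R) n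
      = \sum_(j < N | j == n :> nat) (thermal_weight b n)%:C * u n.
    rewrite [RHS]big_mkcond/=; apply: eq_bigr => j _.
    rewrite -[LHS]/((thermal_weight b j)%:C * braket (fock R j) u * fock R j n).
    rewrite braket_fock//= /fock_seq eq_sym.
    by case: eqVneq => [->|_]; rewrite ?mulr1 ?mulr0.
  case: ltnP => nN.
    by rewrite (big_pred1 (Ordinal nN)) ?subrr// => j; rewrite -val_eqE.
  rewrite big_pred0 ?subr0// => j.
  by apply/negbTE; rewrite neq_ltn (leq_trans (ltn_ord j) nN).
have w1 n : thermal_weight b n ^+ 2 <= 1.
  rewrite exprn_ile1//; first exact/ltW/thermal_weight_gt0.
  have e1 : expR (- b) <= 1 by rewrite -expR0 ler_expR oppr_le0 ltW.
  have en : expR (- (b * n%:R)) <= 1 by rewrite -expR0 ler_expR oppr_le0 mulr_ge0// ltW.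
  by rewrite mulr_ile1 ?subr_ge0 ?expR_ge0// gerBl expR_ge0.
have s0 (k : nat) : (0 <= (sqmod (u k))%:E)%E by rewrite lee_fin sqmod_ge0.
have tail := nneseries_tail_cvg us (fun k _ => s0 k).
have bnd N : (sqnorm (r N) <= \sum_(N <= k <oo) (sqmod (u k))%:E)%E.
  rewrite /sqnorm (nneseries_split 0 N); last by move=> k _; rewrite lee_fin sqmod_ge0.
  rewrite add0n big1_seq => [|n]; last first.
    move=> /andP[_]; rewrite mem_index_iota leq0n andTb => nN.
    by rewrite rE nN /sqmod/= expr0n/= addr0.
  rewrite add0e; apply: lee_nneseries => n Nn; first by rewrite lee_fin sqmod_ge0.
  rewrite lee_fin rE; case: ifP => _.
    by rewrite {1}/sqmod/= expr0n/= addr0 sqmod_ge0.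
  by rewrite sqmodM sqmod_real ler_piMl ?sqmod_ge0.
apply: (@squeeze_cvge _ \oo _ _ (fun=> 0%E) _ _ _ 0%E (cvg_cst _) tail).
near=> N; apply/andP; split; last exact: bnd.
by apply: nneseries_ge0 => n _ _; rewrite lee_fin sqmod_ge0.
Unshelve. all: by end_near. Qed.

Lemma sqmod_fock (R : realType) (j n : nat) : sqmod (fock R j n) = (n == j)%:R.
Proof.
by rewrite /= /fock_seq; case: (n == j); rewrite /sqmod/= ?expr1n ?expr0n/= addr0.
Qed.

Lemma cvg_series_single (R : realType) (k : nat) (c : R) :
  series (fun n => if n == k then c else 0) @ \oo --> c.
Proof.
apply: cvg_near_cst; near=> N; rewrite /series/= -big_mkcond/= big_nat1_eq/=.
have -> // : (k < N)%N; near: N; exact: nbhs_infty_gt.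
Unshelve. all: by end_near. Qed.

Lemma sqnorm_annih_fock (R : realType) (j : nat) :
  sqnorm (annih (fock R j)) = (j%:R : R)%:E.
Proof.
rewrite sqnorm_annihE; apply: eseries_EFin.
have -> : (fun n => n%:R * sqmod (fock R j n)) = (fun n => if n == j then j%:R else 0).
  by apply/funext => n; rewrite sqmod_fock; case: eqVneq => [->|_]; rewrite ?mulr1 ?mulr0.
exact: cvg_series_single.
Qed.

Lemma ladder_fock (R : realType) (b : R) (j : nat) : 0 < b ->
  ladder_sq _ (thermal_weight b) (fock R) j = j%:R.
Proof.
move=> b0; rewrite /ladder_sq thermal_weight_gt0//.
have s : annih (fock R j) \in @square_summable R.
  by rewrite unfold_in /square_summable sqnorm_annih_fock ltry.
by have := (sqnormE _ _ s).1; rewrite sqnorm_annih_fock => -[].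
Qed.

Lemma thermal_weightS (R : realType) (b : R) (n : nat) :
  thermal_weight b n.+1 = expR (- b) * thermal_weight b n.
Proof. by rewrite !thermal_weightE /= exprS mulrCA. Qed.

Lemma finite_mean_photon_thermal (R : realType) (b : R) : 0 < b ->
  finite_mean_photon (thermal_weight b) (fock R).
Proof.
move=> b0; split => [j _|].
  by rewrite /dom_annih unfold_in /square_summable sqnorm_annih_fock ltry.
set q := expR (- b); have q0 : 0 < q by exact: expR_gt0.
have q1 : q < 1 by rewrite -expR0 ltr_expR oppr_lt0.
have t0 (n : nat) : 0 <= thermal_weight b n * n%:R :> R.
  by rewrite mulr_ge0// ltW// thermal_weight_gt0.
have -> : mean_num (thermal_weight b) (fock R)
    = (\sum_(0 <= j <oo) (thermal_weight b j * j%:R)%:E)%E.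
  by apply: eq_eseriesr => j _; rewrite sqnorm_annih_fock.
apply: (@le_lt_trans _ _ (q / (1 - q))%:E); last exact: ltry.
apply: lime_le; first by apply: is_cvg_nneseries => n _ _; rewrite lee_fin.
apply: nearW => M; rewrite sumEFin lee_fin.
(* Closed form of the partial sums of (1 - q) j q^j, whose limit q / (1 - q) is also the bound. *)
have -> : \sum_(0 <= j < M) thermal_weight b j * j%:R
    = (q - q ^+ M.+1) / (1 - q) - M%:R * q ^+ M.
  elim: M => [|M IH]; first by rewrite big_geq// expr1 subrr mul0r mul0r subr0.
  rewrite big_nat_recr//= IH thermal_weightE /= -/q -natr1 !exprS; field; lra.
have qM : 0 <= M%:R * q ^+ M by rewrite mulr_ge0// exprn_ge0// ltW.
have qM1 : 0 <= q ^+ M.+1 / (1 - q).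
  by rewrite divr_ge0 ?exprn_ge0 ?subr_ge0// ltW.
by rewrite mulrBl; lra.
Qed.

Lemma mean_num_thermal (R : realType) (b : R) : 0 < b ->
  let N := expR (- b) / (1 - expR (- b)) in
  mean_num (thermal_weight b) (fock R) = N%:E
  /\ series (fun j => thermal_weight b j * ladder_sq _ (thermal_weight b) (fock R) j)
       @ \oo --> N.
Proof.
move=> b0; cbv zeta; set q := expR (- b).
have q1 : q < 1 by rewrite -expR0 ltr_expR oppr_lt0.
have w0 j : 0 <= thermal_weight b j by exact/ltW/thermal_weight_gt0.
have [N NE cN] := mean_numE _ _ _ w0 (finite_mean_photon_thermal _ _ b0).
suff <- : N = q / (1 - q) by [].
have cw := thermal_weight_sum _ _ b0.
set s := series _ in cN.
(* The weights are geometric, so shifting the index gives a recursion whose limit is N = q (N +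
   1). *)
have sS M : s M.+1 = q * (s M + series (thermal_weight b) M).
  rewrite /s /series/= big_nat_recl//= ladder_fock// mulr0 add0r.
  rewrite -big_split/= mulr_sumr; apply: eq_bigr => j _.
  by rewrite !ladder_fock// thermal_weightS -/q -natr1; ring.
have c1 : s M.+1 @[M --> \oo] --> N by rewrite (cvg_shiftS s).
have c2 : s M.+1 @[M --> \oo] --> q * (N + 1).
  by under eq_fun do rewrite sS; apply: cvgMr; exact: cvgD.
have : N = q * (N + 1) by rewrite -[LHS](cvg_lim _ c1)// (cvg_lim _ c2).
by move=> e; apply: (@mulIf _ (1 - q)); [lra|rewrite divfK; lra].
Qed.

Lemma transition_fock (R : realType) (b : R) (i j : nat) : 0 < b ->
  transition _ (thermal_weight b) (fock R) i j = if j == i.+1 then i.+1%:R else 0.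
Proof.
move=> b0; rewrite /transition !thermal_weight_gt0//= braket_fock; last first.
  by rewrite unfold_in /square_summable sqnorm_annih_fock ltry.
rewrite /annih sqmodM sqmod_real sqr_sqrtr// -[fock_seq _ _]/(fock R j : nat -> R[i]).
by rewrite sqmod_fock eq_sym; case: eqP; rewrite ?mulr1 ?mulr0.
Qed.

Lemma jump_density_thermal (R : realType) (beta b th N : R) : 0 < b ->
  series (fun j => thermal_weight b j * ladder_sq _ (thermal_weight b) (fock R) j)
    @ \oo --> N ->
  (\sum_(0 <= i <oo) \sum_(0 <= j <oo)
     (jump_density _ beta th (thermal_weight b) (fock R) i j)%:E
   = (skew _ beta th * expR (- (b * th)) * (N + 1)
      + (skew _ beta th)^-1 * expR (b * th) * N)%:E)%E.
Proof.
move=> b0 cN; set w := thermal_weight b; set k := skew _ _ _.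
have w0 i : 0 < w i by exact: thermal_weight_gt0.
pose c1 (i : nat) := k * expR (- (b * th)) * (w i * i%:R + w i).
pose c2 (i : nat) := k^-1 * expR (b * th) * (w i * i%:R).
have wpow (i : nat) (s : R) : w i `^ (1 - s) * w i `^ s = w i.
  by rewrite -powRD ?(gt_eqF (w0 i)) ?implybT// subrK powRr1// ltW.
have wS i (s : R) : w i.+1 `^ s = expR (- (b * s)) * w i `^ s.
  by rewrite /w thermal_weightS powRM ?expR_ge0 ?ltW// -expRM mulNr.
have alg1 (c x y z n : R) : c * (x * (y * z) * (n + 1)) = c * y * (x * z * n + x * z).
  by ring.
have alg2 (c x y z u n : R) : c * (x * y * z * u * n) = c * x * (y * (z * u) * n).
  by ring.
have row i : (\sum_(0 <= j <oo) (jump_density _ beta th w (fock R) i j)%:E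
    = (c1 i + c2 i)%:E)%E.
  apply: eseries_EFin.
  (* Row i has entries only at [i.+1] and [i.-1]. For i = 0 the index [i.-1] is 0 itself, which does
     no harm because [c2 0 = 0]. *)
  have -> : series (fun j => jump_density _ beta th w (fock R) i j)
    = series (fun j => if j == i.+1 then c1 i else 0)
      \+ series (fun j => if j == i.-1 then c2 i else 0).
    apply/funext => M; rewrite /series/= -big_split/=; apply: eq_bigr => j _.
    rewrite /jump_density !transition_fock// -/k; congr (_ + _).
      case: eqP => [->|_]; last by rewrite !mulr0.
      by rewrite wS -natr1 alg1 (wpow i th).
    case: i => [|i] /=.
      by rewrite /c2 !mulr0 if_same.
    rewrite eqSS eq_sym; case: eqP => [->|_]; last by rewrite !mulr0.
    have e : expR (- (b * (1 - th))) = expR (b * th) * expR (- b).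
      by rewrite -expRD; congr expR; ring.
    by rewrite (wS _ (1 - th)) e alg2 (wpow _ th) /c2 /w thermal_weightS.
  by apply: cvgD; exact: cvg_series_single.
under eq_eseriesr do rewrite row.
apply: eseries_EFin.
have cw := thermal_weight_sum _ _ b0.
pose s := series (fun j => w j * ladder_sq _ w (fock R) j).
have -> : series (fun i => c1 i + c2 i) = (fun M =>
    k * expR (- (b * th)) * (s M + series w M) + k^-1 * expR (b * th) * s M).
  apply/funext => M; rewrite /s /series/= -big_split/= !mulr_sumr -big_split/=.
  by apply: eq_bigr => i _; rewrite ladder_fock.
by apply: cvgD; apply: cvgMr => //; exact: cvgD.
Qed.

(** For q = e^(-b) one has N = q / (1 - q) and N + 1 = 1 / (1 - q). The means and the jump sums
    recombine into the product [gap] over the common denominator 1 - q. *)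
Lemma dirichlet_thermal (R : realType) (beta b p : R) : 0 < b -> 1 < p ->
  dirichlet_gt1 beta p (thermal_weight b) (fock R)
  = (gap _ (- (beta / 2)) (beta / 2 - b) p^-1 / (p^-1 * (1 - p^-1))
     * (4 * (1 - expR (- b)))^-1)%:E.
Proof.
move=> b0 p1; have w0 j : 0 <= thermal_weight b j by exact/ltW/thermal_weight_gt0.
have q1 : expR (- b) < 1 by rewrite -expR0 ltr_expR oppr_lt0.
have [] := mean_num_thermal _ _ b0; set N := _ / _ => NE cN.
have aE := mean_antinumE _ _ _ N w0 (finite_mean_photon_thermal _ _ b0)
  (@fock_orthonormal R) (thermal_weight_sum _ _ b0) NE.
have JE := jump_density_thermal _ beta b p^-1 N b0 cN.
have [|H HE ->] := dirichlet_gt1E _ beta p _ _ N p1 w0 NE aE; first by rewrite JE ltry.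
move: HE; rewrite JE => -[<-]; congr EFin.
rewrite hoelder_prod// gapE !expRB.
have -> : expR (- (b / p)) = (expR (b / p))^-1 by rewrite expRN.
rewrite /N [expR (- b)]expRN in q1 *; set k := skew _ _ _; set x := expR (b / p).
have x0 : 0 < x by exact: expR_gt0.
have k0 : 0 < k by exact: skew_gt0.
have y0 : 0 < expR b by exact: expR_gt0.
have y1 : 1 < expR b by rewrite expR_gt1.
set y := expR b in y0 y1 *; set e1 := expR _; set e2 := expR _.
have hp : 0 < 1 - p^-1 by rewrite subr_gt0 invf_lt1//; lra.
set h := 1 - p^-1 in hp *.
field; rewrite !gt_eqF//=; lra.
Qed.

(** The relative entropy of the thermal state of parameter b times 1 - e^(-b). The factor
    compensates the growth of the mean photon number as b tends to 0, so that a finite positive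
    limit exists. *)
Definition scaled_entropy (R : realType) (beta b : R) : R :=
  (1 - expR (- b)) * ln (1 - expR (- b)) - (1 - expR (- b)) * ln (1 - expR (- beta))
  + (beta - b) * expR (- b).

Lemma rel_entropy_thermal (R : realType) (beta b : R) : 0 < b -> 0 < beta -> b != beta ->
  0 < scaled_entropy _ beta b /\
  rel_entropy beta (thermal_weight b) (fock R)
  = (scaled_entropy _ beta b / (1 - expR (- b)))%:E.
Proof.
move=> b0 beta0 bb; have q1 : 0 < 1 - expR (- b).
  by rewrite subr_gt0 -expR0 ltr_expR oppr_lt0.
have [_ cN] := mean_num_thermal _ _ b0; set N := _ / _ in cN.
have [S [cS D0 DE]] := rel_entropyP _ _ _ _ _ _ beta0 (state_thermal _ _ b0)
  (thermal_neq _ _ _ b0 beta0 bb) (eigen_thermal_fock _ _ b0)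
  (finite_mean_photon_thermal _ _ b0) cN.
have SE : S = ln (1 - expR (- b)) - b * N.
  have c : series (fun j => thermal_weight b j * ln (thermal_weight b j)) @ \oo
      --> ln (1 - expR (- b)) * 1 - b * N.
    have -> : series (fun j => thermal_weight b j * ln (thermal_weight b j)) = (fun M =>
        ln (1 - expR (- b)) * series (thermal_weight b) M
        - b * series (fun j => thermal_weight b j
            * ladder_sq _ (thermal_weight b) (fock R) j) M).
      apply/funext => M; rewrite /series/= !mulr_sumr -sumrB; apply: eq_bigr => j _.
      by rewrite ladder_fock// ln_thermal_weight//; ring.
    by apply: cvgB; apply: cvgMr => //; exact: thermal_weight_sum.
  by rewrite -(cvg_lim _ cS)// (cvg_lim _ c)// mulr1.
have E : S - ln (1 - expR (- beta)) + beta * N = scaled_entropy _ beta b / (1 - expR (- b)).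
  by rewrite SE /scaled_entropy /N; field; lra.
rewrite DE E; split => //; rewrite E in D0.
by rewrite -(pmulr_lgt0 _ (x := (1 - expR (- b))^-1)) ?invr_gt0.
Qed.

Lemma scaled_entropy_cvg (R : realType) (beta : R) :
  scaled_entropy _ beta b @[b --> (0 : R)^'+] --> beta.
Proof.
have E : (1 - expR (- 0)) * ln (1 - expR (- 0))
    - (1 - expR (- 0)) * ln (1 - expR (- beta)) + (beta - 0) * expR (- 0) = beta :> R.
  by rewrite !(oppr0, expR0, subrr, mul0r, addr0, add0r, mulr1).
rewrite -[X in _ --> X]E.
have ce : expR (- b) @[b --> (0 : R)^'+] --> expR (- 0 : R).
  apply: cvg_at_right_filter; apply: (continuous_comp (f := -%R) (g := expR)).
    exact: opp_continuous.
  exact: continuous_expR.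
have c1 : 1 - expR (- b) @[b --> (0 : R)^'+] --> 1 - expR (- 0 : R).
  by apply: cvgB ce; exact: cvg_cst.
have cb : b @[b --> (0 : R)^'+] --> (0 : R) by apply: cvg_at_right_filter; exact: cvg_id.
apply: cvgD; last by apply: cvgM ce; apply: cvgB cb; exact: cvg_cst.
apply: cvgB; last by apply: cvgM c1 _; exact: cvg_cst.
have := @continuous_xlnx R (1 - expR (- 0)) => cx.
exact: (continuous_cvg _ cx c1).
Qed.

(** * Upper bounds and the value of the constant *)

(** In the quotient of form and relative entropy the factors 1 - e^(-b) cancel, leaving f b /
    [scaled_entropy _ beta b]. Restricting to b < beta excludes sigma itself. The numerator f is
    left abstract to serve both p > 1 and p = 1. *)
Lemma thermal_upper (R : realType) (beta p : R) (f : R -> R) :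
  0 < beta -> f b @[b --> (0 : R)^'+] --> f 0 ->
  (forall b, 0 < b -> b < beta ->
     dirichlet beta p (thermal_weight b) (fock R) = (f b / (1 - expR (- b)))%:E) ->
  (lsi_const beta p <= (f 0 / beta)%:E)%E.
Proof.
move=> beta0 cf dE.
have c : (f b / scaled_entropy _ beta b)%:E @[b --> (0 : R)^'+] --> (f 0 / beta)%:E.
  apply: cvg_EFin; first exact: nearW.
  apply: cvgM => //; apply: cvgV; first by rewrite gt_eqF.
  exact: scaled_entropy_cvg.
apply: cvge_ge c; near=> b.
have b0 : 0 < b by near: b; exact: nbhs_right_gt.
have bb : b < beta by near: b; exact: nbhs_right_lt.
have bn : b != beta by rewrite lt_eqF.
have [Z0 RE] := rel_entropy_thermal _ _ _ b0 beta0 bn.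
have q1 : 0 < 1 - expR (- b) by rewrite subr_gt0 -expR0 ltr_expR oppr_lt0.
apply: ereal_inf_lbound.
exists (@thermal R b), (thermal_weight b), (fock R); split.
- exact: state_thermal.
- exact: thermal_neq.
- exact: eigen_thermal_fock.
- exact: finite_mean_photon_thermal.
- rewrite RE dE// ediv_fin ?divr_gt0//; congr EFin; field.
  by rewrite !gt_eqF.
Unshelve. all: by end_near. Qed.

Lemma lsi_const_gt1 (R : realType) (beta p : R) : 0 < beta -> 1 < p ->
  lsi_const beta p = (lsi_value _ beta p)%:E.
Proof.
move=> beta0 p1; apply/eqP; rewrite eq_le lsi_const_ge// andbT.
pose f b := gap _ (- (beta / 2)) (beta / 2 - b) p^-1 / (p^-1 * (1 - p^-1)) / 4.
have -> : lsi_value _ beta p = f 0 / beta.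
  by rewrite /lsi_value /f hoelder_prod// lsi_rate_gap// subr0; ring.
apply: thermal_upper => // [|b b0 bb]; last first.
  by rewrite /dirichlet gt_eqF// dirichlet_thermal// (invfM 4) mulrA.
have ce (a : R) : expR ((beta / 2 - b) * a) @[b --> (0 : R)^'+] --> expR ((beta / 2 - 0) * a).
  have c : (beta / 2 - b) * a @[b --> (0 : R)^'+] --> (beta / 2 - 0) * a.
    by apply: cvgMl; apply: cvgB; [exact: cvg_cst|apply: cvg_at_right_filter; exact: cvg_id].
  by apply: continuous_cvg c; exact: continuous_expR.
rewrite /f /gap; do 2 apply: cvgMl.
by apply: cvgM; apply: cvgB (ce _); exact: cvg_cst.
Qed.

Lemma lsi_const1 (R : realType) (beta : R) : 0 < beta ->
  lsi_const beta 1 = (2^-1 * sinh (beta / 2))%:E.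
Proof.
move=> beta0; apply/eqP; rewrite eq_le lsi_const1_ge// andbT.
(* A quarter of the limit in [gap_slope] at a1 = - beta/2 and a2 = beta/2 - b. *)
pose f b := (expR (- (beta / 2)) - expR (beta / 2 - b)) * (- (beta / 2) - (beta / 2 - b)) / 4.
have -> : 2^-1 * sinh (beta / 2) = f 0 / beta.
  by rewrite /sinh /f subr0; field; rewrite gt_eqF.
apply: thermal_upper => // [|b b0 bb].
  have cb : b @[b --> (0 : R)^'+] --> (0 : R) by apply: cvg_at_right_filter; exact: cvg_id.
  have cd : beta / 2 - b @[b --> (0 : R)^'+] --> beta / 2 - 0.
    by apply: cvgB cb; exact: cvg_cst.
  rewrite /f; apply: cvgMl; apply: cvgM; apply: cvgB (cvg_cst _) _ => //.
  by apply: continuous_cvg cd; exact: continuous_expR.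
rewrite /dirichlet eqxx; apply/cvg_lim => //.
have c : (gap _ (- (beta / 2)) (beta / 2 - b) q^-1 / (q^-1 * (1 - q^-1))
    * (4 * (1 - expR (- b)))^-1)%:E @[q --> (1 : R)^'+] --> (f b / (1 - expR (- b)))%:E.
  have -> : f b / (1 - expR (- b)) = (expR (- (beta / 2)) - expR (beta / 2 - b))
      * (- (beta / 2) - (beta / 2 - b)) * (4 * (1 - expR (- b)))^-1.
    by rewrite (invfM 4) mulrA.
  apply: cvg_EFin; first exact: nearW.
  by apply: cvgMl; exact: gap_slope.
apply: cvg_trans c; apply: near_eq_cvg; near=> q.
by rewrite dirichlet_thermal//; near: q; exact: nbhs_right_gt.
Unshelve. all: by end_near. Qed.

Theorem theorem4 (R : realType) (beta : R) (beta_gt0 : 0 < beta) :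
  (forall p p' : R, 1 < p -> p^-1 + p'^-1 = 1 ->
     lsi_const beta p =
       (p * p' / (4 * beta) * expR (beta / 2)
        * (1 - expR (- (beta / p))) * (1 - expR (- (beta / p'))))%:E)
  /\ lsi_const beta p @[p --> 1^'+] --> lsi_const beta 1
  /\ lsi_const beta 1 = (2^-1 * sinh (beta / 2))%:E.
Proof.
split; first by move=> p p' p1 pp'; rewrite lsi_const_gt1// (lsi_valueE _ _ _ p').
split; last exact: lsi_const1.
rewrite lsi_const1//.
have c : (lsi_value _ beta p)%:E @[p --> (1 : R)^'+] --> (2^-1 * sinh (beta / 2))%:E.
  by apply: cvg_EFin; [exact: nearW|exact: lsi_value_cvg].
apply: cvg_trans c; apply: near_eq_cvg; near=> p.
by rewrite lsi_const_gt1//; near: p; exact: nbhs_right_gt.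
Unshelve. all: by end_near. Qed.
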